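(* Let $0<\alpha<1$, let $T_\alpha:[0,1)\to[0,1)$ be the intermittent map, let $\mu$ be its absolutely continuous invariant probability measure, and let $r_n^\alpha(x)$ and $R_n^\alpha(x)$ denote the maximal lengths of runs of consecutive digits $0$ and of consecutive digits $1$, respectively, among the first $n$ digits of $x$. Then for $\mu$-almost all $x\in[0,1)$, $$\lim_{n\to\infty}\frac{\log r_n^\alpha(x)}{\log n^{\alpha}}=1,$$ and $$\lim_{n\to\infty}\frac{R_n^\alpha(x)}{\log_2 n}=1.$$
   Context: For $0<\alpha<1$ the intermittent map $T=T_\alpha:[0,1)\to[0,1)$ is defined by $T_\alpha(x)=x(1+2^\alpha x^\alpha)$ if $0\le x<1/2$, and $T_\alpha(x)=2x-1$ if $1/2\le x<1$. It is known that $T_\alpha$ has a unique invariant probability measure absolutely continuous with respect to Lebesgue measure; this measure is denoted $\mu$. Let $I_0=[0,1/2)$ and $I_1=[1/2,1)$. For $x\in[0,1)$ and an integer $k\ge 1$, the $k$-th digit of $x$ is $\varepsilon_k(x)=j$ if $T^{k-1}(x)\in I_j$, $j\in\{0,1\}$. For $n\ge1$ define $$r_n^\alpha(x)=\max\{k\ge 0:\ \varepsilon_{i+1}(x)=\cdots=\varepsilon_{i+k}(x)=0\ \text{for some}\ 0\le i\le n-k\},$$ $$R_n^\alpha(x)=\max\{k\ge 0:\ \varepsilon_{i+1}(x)=\cdots=\varepsilon_{i+k}(x)=1\ \text{for some}\ 0\le i\le n-k\}.$$ *)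

(* Defs.v *)
From HB Require Import structures.
From mathcomp Require Import all_boot all_order all_algebra.
From mathcomp Require Import all_classical all_reals all_analysis.
From mathcomp Require Import lra.

Set Implicit Arguments.
Unset Strict Implicit.
Unset Printing Implicit Defensive.

Import Order.TTheory GRing.Theory Num.Theory.
Import numFieldNormedType.Exports.

Local Open Scope classical_set_scope.
Local Open Scope ring_scope.

(* The phase space [0, 1) is a subset of R; the map and the digits are total
   functions on R whose values outside [0, 1) are irrelevant. *)
Definition unitI (R : realType) : set R := `[0, 1[.
Arguments unitI : clear implicits.

Definition intermittent (R : realType) (a : R) (x : R) : R :=
  if x < 2^-1 then x * (1 + 2 `^ a * x `^ a) else 2 * x - 1.

Lemma intermittent_unitI (R : realType) (a : R) (x : R) :
  0 < a -> unitI R x -> unitI R (intermittent a x).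
Proof.
rewrite /unitI /= !in_itv /= => a0 /andP[x0 x1]; rewrite /intermittent.
case: ltP => [xh|hx]; last first.
  by rewrite subr_ge0 mulrC -ler_pdivrMr// div1r hx/= ltrBlDr -[ltRHS]mulr1
    [x * 2]mulrC ltr_pM2l.
have p0 : 0 <= (2 * x) `^ a by rewrite powR_ge0.
have x21 : 2 * x <= 1 by lra.
have p1 : (2 * x) `^ a <= 1.
  have e1 : 1 `^ a = 1 :> R by rewrite powR1.
  rewrite -[leRHS]e1; apply: ge0_ler_powR => //; rewrite ?nnegrE; lra.
rewrite -powRM//; apply/andP; split; nra.
Qed.

(* Digits are numbered from k = 1; the value at k = 0 is junk. *)
Definition digit (R : realType) (a : R) (k : nat) (x : R) : nat :=
  if iter k.-1 (intermittent a) x < 2^-1 then 0%N else 1%N.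

(* The requirement 0 <= i <= n - k, with integer subtraction, is i + k <= n;
   k = 0 always qualifies, so the maximum is over a nonempty set. *)
Definition max_run (R : realType) (a : R) (b n : nat) (x : R) : nat :=
  (\max_(k < n.+1 | [exists i : 'I_n.+1, (i + k <= n) &&
      [forall j : 'I_k, digit a (i + j.+1) x == b]]) k)%N.

(* A probability measure on [0, 1) is encoded as a Borel probability measure on
   R carried by [0, 1).  For 0 < a < 1 exactly one measure satisfies this
   predicate. *)
Definition is_acip (R : realType) (a : R)
    (mu : probability (measurableTypeR R) R) : Prop :=
  [/\ mu (unitI R) = 1%E,
      (forall A : set (measurableTypeR R), measurable A -> A `<=` unitI R ->
         mu (unitI R `&` intermittent a @^-1` A) = mu A) &
      mu `<< (@lebesgue_measure R)].

Definition log2 (R : realType) (x : R) : R := ln x / ln 2.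

(* Main.v *)
Require Import Defs.
From HB Require Import structures.
From mathcomp Require Import all_boot all_order all_algebra.
From mathcomp Require Import all_classical all_reals all_analysis.
From mathcomp Require Import lra ring zify.

Set Implicit Arguments.
Unset Strict Implicit.
Unset Printing Implicit Defensive.

Import Order.TTheory GRing.Theory Num.Theory.
Import numFieldNormedType.Exports.

Local Open Scope classical_set_scope.
Local Open Scope ring_scope.

(** The bounds hold for Lebesgue almost every point, hence for almost every
    point of any absolutely continuous measure.

    Both branches of the map are onto, so the first [n] digits being [w] means
    that the point lies in an interval, the image of the unit interval under the
    inverse branch [word_inv w].  The map is convex on the left and affine on the
    right, so the derivative of [word_inv w], that is the conditional density of
    the [n]-th iterate given the past [w], is nonincreasing; and it decreases
    slowly, its product with [y ^+ 2] being nondecreasing ([LSV_cone_word]).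
    Four bounds follow, uniformly in [w], with [c k] the length of the cylinder
    of [k] zeros: given the past, a run of [k] ones has probability at most
    [2 ^- k], and a one followed by [k] zeros at most [c k]; a run of [k] zeros
    has probability at least [c k], and after a one a run of [k] ones has
    probability of order at least [2 ^- k].  Near the neutral fixed point the map
    is [x + 2 `^ a * x `^ (1 + a)], whence [c k] is of order [k `^ (- 1 / a)].

    The upper bounds on the runs are a union bound over the starting times and
    the Borel-Cantelli lemma along [n = 2 ^ (q * i)]: [n] trials of probability
    [2 ^- k] or [k `^ (- 1 / a)] succeed only for [k] at most [(1 + e) * log2 n]
    or [n `^ (a * (1 + e))], with [e] small when [q] is large.  A run of zeros
    is counted at its beginning, after a one: in the middle of a long run the
    conditional probability is not small.

    For the lower bounds every one starts a trial for a long run of zeros, and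
    one for a long run of ones, and the trials behave as if they were independent
    ([zero_trials], [one_trials]).  It remains to see that there are nearly [n]
    ones among [n] digits.  The probability that [L] zeros occur at a given time
    is at most the sum of the [c j] over [j >= L] ([prob_zero_window]), which
    tends to [0] like a negative power of [L] because [a < 1].  By Markov's
    inequality half of the windows of length [L = n `^ (1 / q)] contain a one, so
    that there are at least [n / L] ones up to a constant ([many_ones]).

    All events depend on finitely many digits, so the estimates are made for an
    additive function on binary words ([expect], [prob]) and carried to the
    Lebesgue measure by [code_event_measure]. *)

(** * Tangent inequalities for real powers *)
Section Powers.
Context {R : realType}.
Implicit Types t u v x : R.

(** Young's inequality for the conjugate exponents [(1 + t) / t] and [1 + t]:
    the convex function [z `^ (1 + t)] lies above its tangent at [u].  The
    powers are written as products because this is how they occur in the left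
    branch of the map. *)
Lemma powR_tangent_ge t u v : 0 < t -> 0 <= u -> 0 <= v ->
  u * u `^ t + (1 + t) * u `^ t * (v - u) <= v * v `^ t.
Proof.
move=> t0 u0 v0.
have pq : ((1 + t) / t)^-1 + (1 + t)^-1 = 1 :> R by field; rewrite !gt_eqF//; lra.
have E x : 0 <= x -> x * x `^ t = x `^ (1 + t).
  move=> x0; rewrite -[RHS]mulr_powRB1//; last lra.
  by congr (_ * _ `^ _); ring.
have := @conjugate_powR R (u `^ t) v ((1 + t) / t) (1 + t) (powR_ge0 _ _) v0
  (divr_gt0 _ t0) _ pq.
rewrite -powRrM (_ : t * ((1 + t) / t) = 1 + t); last by field; rewrite !gt_eqF//; lra.
move=> /(_ _ _)/= H.
have {}H : u `^ t * v * (1 + t) <= u `^ (1 + t) * t + v `^ (1 + t).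
  have t1 : 0 < 1 + t by lra.
  rewrite -ler_pdivlMr//; apply: le_trans (H t1 t1) _.
  by rewrite le_eqVlt; apply/orP/or_introl/eqP; field; rewrite !gt_eqF.
rewrite E// E//.
have := E _ u0 => Eu; nra.
Qed.

(** The concave function [x `^ t] lies below its tangent at [1]; again Young's
    inequality, now with exponents [1 / t] and [1 / (1 - t)]. *)
Lemma powR_le_affine t x : 0 <= t <= 1 -> 0 <= x -> x `^ t <= 1 + t * (x - 1).
Proof.
move=> /andP[]; rewrite le_eqVlt => /predU1P[<- _ _|t0].
  by rewrite powRr0; lra.
rewrite le_eqVlt => /predU1P[-> x0|t1 x0]; first by rewrite powRr1//; lra.
have pq : (t^-1)^-1 + ((1 - t)^-1)^-1 = 1 :> R by rewrite !invrK; ring.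
have := @conjugate_powR R (x `^ t) 1 t^-1 (1 - t)^-1 (powR_ge0 _ _) ler01.
rewrite !invr_gt0 subr_gt0 pq => /(_ t0 t1 erefl).
by rewrite -powRrM divff ?gt_eqF// powRr1// powR1 !invrK; lra.
Qed.

End Powers.

(** * The inverse branches and the invariant cone of densities *)
Section Branches.
Context {R : realType} (a : R).
Hypotheses (a0 : 0 < a) (a1 : a < 1).
Implicit Types x y z : R.

Definition left_map (x : R) : R := x * (1 + 2 `^ a * x `^ a).

Definition left_slope (x : R) : R := 1 + (1 + a) * (2 * x) `^ a.

Lemma left_mapE x : 0 <= x -> left_map x = x * (1 + (2 * x) `^ a).
Proof. by move=> x0; rewrite /left_map powRM. Qed.

Lemma dbl_powR_le x y : 0 <= x -> x <= y -> (2 * x) `^ a <= (2 * y) `^ a.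
Proof.
by move=> x0 xy; apply: ge0_ler_powR; rewrite ?nnegrE; (exact: ltW || lra).
Qed.

Lemma dbl_powR_le1 x : 0 <= x <= 2^-1 -> (2 * x) `^ a <= 1.
Proof.
move=> /andP[x0 x1]; have := dbl_powR_le x0 x1.
by rewrite divff// powR1.
Qed.

Lemma left_slope_gt0 x : 0 < left_slope x.
Proof.
rewrite /left_slope; have := powR_ge0 (2 * x) a => h; have ? := a0; nra.
Qed.

(** Convexity of the left branch.  Used in both directions, at the two ends of
    an interval, it replaces all derivatives of the inverse branch. *)
Lemma left_tangent x z : 0 <= x -> 0 <= z ->
  left_slope x * (z - x) <= left_map z - left_map x.
Proof.
move=> x0 z0; rewrite !left_mapE// /left_slope.
have ? := a0; have := @powR_tangent_ge R a (2 * x) (2 * z) a0.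
by move=> /(_ _ _); nra.
Qed.

Lemma left_map0 : left_map 0 = 0. Proof. by rewrite /left_map mul0r. Qed.

Lemma left_map_half : left_map 2^-1 = 1.
Proof. by rewrite left_mapE// divff// powR1; lra. Qed.

Lemma left_map_lt x z : 0 <= x -> x < z -> left_map x < left_map z.
Proof.
move=> x0 xz; have z0 : 0 <= z by lra.
have := left_tangent x0 z0; have := left_slope_gt0 x => h1 h2; nra.
Qed.

Lemma left_map_inj x z : 0 <= x -> 0 <= z -> left_map x = left_map z -> x = z.
Proof.
move=> x0 z0 e; case: (ltgtP x z) => // h.
- by have := left_map_lt x0 h; rewrite e ltxx.
- by have := left_map_lt z0 h; rewrite e ltxx.
Qed.

(** The intermediate value theorem is applied on [[y / 2, 1 / 2]], away from
    the point [0] where differentiability of the power fails: the left branch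
    at most doubles its argument, so the preimage of [y] is at least [y / 2]. *)
Lemma left_map_surj y : 0 <= y <= 1 ->
  exists x, 0 <= x <= 2^-1 /\ left_map x = y.
Proof.
move=> /andP[]; rewrite le_eqVlt => /predU1P[<- _|y0 y1].
  by exists 0; rewrite left_map0; split=> //; lra.
have yh : y / 2 <= 2^-1 by lra.
have : {within `[y / 2, 2^-1], continuous left_map}.
  apply: continuous_in_subspaceT => x; rewrite inE/= in_itv/= => /andP[x0 _].
  have c : {for x, continuous (@powR R ^~ a)}.
    apply: differentiable_continuous; apply/derivable1_diffP.
    by apply: derivable_powR; rewrite in_itv/= andbT; lra.
  apply: (@continuousM _ _ id); first exact: cvg_id.
  apply: (@continuousD _ _ _ (cst 1 : R -> R)); first exact: cvg_cst.
  by apply: (@continuousM _ _ (cst (2 `^ a) : R -> R)) => //; exact: cvg_cst.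
move=> cont; have [|x] := @IVT R left_map _ _ y yh cont.
  have l1 : left_map (y / 2) <= y.
    rewrite left_mapE; last lra.
    have := @dbl_powR_le1 (y / 2) ltac:(lra) => h; nra.
  by rewrite left_map_half ge_min le_max l1 y1 orbT.
rewrite in_itv/= => /andP[x0 x1] <-.
by exists x; split=> //; lra.
Qed.

Definition left_inv (y : R) : R :=
  xget 0 [set x | 0 <= x <= 2^-1 /\ left_map x = y].

Lemma left_invP y : 0 <= y <= 1 ->
  0 <= left_inv y <= 2^-1 /\ left_map (left_inv y) = y.
Proof.
move=> y01; have [x Hx] := left_map_surj y01.
exact: (@xgetPex _ 0 [set x | 0 <= x <= 2^-1 /\ left_map x = y]) (ex_intro _ x Hx).
Qed.

Lemma left_invK x : 0 <= x <= 2^-1 -> left_inv (left_map x) = x.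
Proof.
move=> /[dup] x01 /andP[x0 x1].
have m0 : 0 <= left_map x <= 1.
  rewrite left_mapE//; have := dbl_powR_le1 x01; have := powR_ge0 (2 * x) a.
  by move=> ? ?; nra.
have [/andP[? ?] e] := left_invP m0.
exact: left_map_inj.
Qed.

Definition branch_inv (d : bool) (y : R) : R :=
  if d then (1 + y) / 2 else left_inv y.

(** The inverse of the iterate of the map along the digits [w]: a bijection
    from the unit interval onto the cylinder of [w]. *)
Definition word_inv (w : seq bool) (y : R) : R := foldr branch_inv y w.

Lemma branch_inv_itv d y : 0 <= y <= 1 -> 0 <= branch_inv d y <= 1.
Proof. by case: d => /= h; [lra|have [] := left_invP h; lra]. Qed.

Lemma word_inv_itv w y : 0 <= y <= 1 -> 0 <= word_inv w y <= 1.
Proof. by move=> h; elim: w => //= d w; apply: branch_inv_itv. Qed.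

Lemma left_inv_le x y : 0 <= x -> x <= y -> y <= 1 -> left_inv x <= left_inv y.
Proof.
move=> x0 xy y1.
have [h1 e1] := @left_invP x ltac:(lra); have [h2 e2] := @left_invP y ltac:(lra).
rewrite leNgt; apply/negP => /left_map_lt; rewrite e1 e2; lra.
Qed.

(** [D] plays the role of the derivative of [G].  The second clause, with slopes
    compared to the two ends, makes [D] nonincreasing and [G] concave; the third
    one prevents [D] from dropping too fast, and in particular bounds
    [D 2^-1] by [4 * D 1].  This is the cone of densities that Liverani, Saussol
    and Vaienti use for intermittent maps, with [y ^+ 2] in place of
    [y `^ (1 + a)], which keeps its stability a matter of polynomials. *)
Definition LSV_cone (G : R -> R) := exists D : R -> R,
  [/\ forall y, 0 <= y <= 1 -> 0 <= D y,
      forall x y, 0 <= x -> x <= y -> y <= 1 ->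
        D y * (y - x) <= G y - G x <= D x * (y - x) &
      forall x y, 0 <= x -> x <= y -> y <= 1 -> x ^+ 2 * D x <= y ^+ 2 * D y].

Lemma LSV_cone_id : LSV_cone id.
Proof.
exists (fun=> 1); split=> // x y x0 xy y1; first by rewrite !mul1r lexx.
by rewrite !mulr1; nra.
Qed.

(** The chain rule multiplies [D] by the derivative of the branch.  For the
    left branch, with [s = (2 x) `^ a] at the preimage [x] of [y], the third
    clause asks that [(1 + s) ^+ 2 / (1 + (1 + a) * s)] be nondecreasing in
    [s]. *)
Lemma LSV_cone_comp d G : LSV_cone G -> LSV_cone (G \o branch_inv d).
Proof.
move=> [D [D0 DG Dm]]; case: d.
  exists (fun y => D ((1 + y) / 2) / 2); split=> /=.
  - by move=> y y01; apply: divr_ge0 => //; apply: D0; lra.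
  - move=> x y x0 xy y1.
    have := DG ((1 + x) / 2) ((1 + y) / 2) ltac:(lra) ltac:(lra) ltac:(lra).
    lra.
  - move=> x y x0 xy y1.
    have := Dm ((1 + x) / 2) ((1 + y) / 2) ltac:(lra) ltac:(lra) ltac:(lra).
    have := D0 ((1 + y) / 2) ltac:(lra).
    move: (D _) (D _) => u v v0 h.
    (* [y / (1 + y)] is nondecreasing. *)
    have k : x ^+ 2 * (1 + y) ^+ 2 <= y ^+ 2 * (1 + x) ^+ 2.
      by rewrite -!exprMn lerXn2r ?nnegrE; nra.
    have h' : (1 + x) ^+ 2 * u <= (1 + y) ^+ 2 * v by lra.
    suff : (1 + x) ^+ 2 * (x ^+ 2 * u) <= (1 + x) ^+ 2 * (y ^+ 2 * v).
      rewrite ler_pM2l; last by rewrite exprn_gt0//; lra.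
      lra.
    apply: (@le_trans _ _ (x ^+ 2 * ((1 + y) ^+ 2 * v))).
      by rewrite mulrCA ler_wpM2l// exprn_ge0.
    by rewrite mulrA [leRHS]mulrA [(1 + x) ^+ 2 * _]mulrC ler_wpM2r.
exists (fun y => D (left_inv y) / left_slope (left_inv y)); split=> /=.
- move=> y y01; have [h _] := left_invP y01.
  by apply: divr_ge0; [apply: D0; lra|exact: ltW (left_slope_gt0 _)].
- move=> x y x0 xy y1.
  have [hx ex] := @left_invP x ltac:(lra); have [hy ey] := @left_invP y ltac:(lra).
  have le := left_inv_le x0 xy y1.
  have := DG (left_inv x) (left_inv y) ltac:(lra) le ltac:(lra).
  have := D0 (left_inv x) ltac:(lra); have := D0 (left_inv y) ltac:(lra).
  have := @left_tangent (left_inv x) (left_inv y) ltac:(lra) ltac:(lra).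
  have := @left_tangent (left_inv y) (left_inv x) ltac:(lra) ltac:(lra).
  rewrite ex ey.
  have := left_slope_gt0 (left_inv x); have := left_slope_gt0 (left_inv y).
  move: (left_slope _) (left_slope _) (D _) (D _) => sx sy Dx Dy sy0 sx0 ty tx Dy0 Dx0.
  move=> /andP[l1 l2]; apply/andP; split.
    apply: le_trans l1; rewrite -mulrA ler_wpM2l// ler_pdivrMl//; lra.
  apply: (le_trans l2); rewrite -mulrA ler_wpM2l// ler_pdivlMl//; lra.
- move=> x y x0 xy y1.
  have [hx ex] := @left_invP x ltac:(lra); have [hy ey] := @left_invP y ltac:(lra).
  have le := left_inv_le x0 xy y1.
  have := Dm (left_inv x) (left_inv y) ltac:(lra) le ltac:(lra).
  have Dx0 := D0 (left_inv x) ltac:(lra); have Dy0 := D0 (left_inv y) ltac:(lra).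
  rewrite -[X in X ^+ 2 * (_ / _) <= _]ex -[X in _ <= X ^+ 2 * (_ / _)]ey.
  rewrite !left_mapE; [|lra|lra].
  have := @dbl_powR_le (left_inv x) (left_inv y) ltac:(lra) le.
  have := powR_ge0 (2 * left_inv x) a.
  rewrite /left_slope.
  have [? ?] := (a0, a1).
  move: (_ `^ _) (_ `^ _) (D _) (D _) Dx0 Dy0 => s' s v u u0 v0 s0 ss' h.
  have q0 : 0 < 1 + (1 + a) * s by nra.
  have q0' : 0 < 1 + (1 + a) * s' by nra.
  rewrite !exprMn !mulrA ler_pdivrMr// [leRHS]mulrAC ler_pdivlMr//.
  have k : (1 + s) ^+ 2 * (1 + (1 + a) * s') <= (1 + s') ^+ 2 * (1 + (1 + a) * s).
    have : 0 <= (s' - s) * (1 - a + 2 * s + (s' - s) + (1 + a) * s * s' ) by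
      apply: mulr_ge0; nra.
    nra.
  move: h k; set X := left_inv x ^+ 2; set Y := left_inv y ^+ 2 => h k.
  have Yv : 0 <= Y * v by rewrite mulr_ge0// exprn_ge0//; lra.
  have e1 : 0 <= (1 + s) ^+ 2 * (1 + (1 + a) * s').
    by apply: mulr_ge0; [rewrite exprn_ge0//; lra|lra].
  have := ler_wpM2r e1 h; have := ler_wpM2l Yv k; lra.
Qed.

Lemma word_inv_rcons w d : word_inv (rcons w d) = word_inv w \o branch_inv d.
Proof. by apply/funext => y; rewrite /word_inv foldr_rcons. Qed.

Lemma word_inv_cat u w : word_inv (u ++ w) = word_inv u \o word_inv w.
Proof. by apply/funext => y; rewrite /word_inv foldr_cat. Qed.

(** Bounded distortion, uniformly over all words: conditionally on any past, the
    density of the next point lies in the cone. *)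
Lemma LSV_cone_word w : LSV_cone (word_inv w).
Proof.
elim/last_ind: w => [|w d IH]; first exact: LSV_cone_id.
by rewrite word_inv_rcons; apply: LSV_cone_comp.
Qed.
End Branches.

(** * Lengths of cylinders *)
Section Words.
Context {R : realType} (a : R).
Hypotheses (a0 : 0 < a) (a1 : a < 1).
Implicit Types (x y z : R) (w u : seq bool) (k n : nat).

Local Notation word_inv := (word_inv a).
Local Notation branch_inv := (branch_inv a).
Local Notation left_inv := (left_inv a).
Local Notation left_map := (left_map a).

Definition word_len w : R := word_inv w 1 - word_inv w 0.

Definition zero_len k : R := word_inv (nseq k false) 1.

Lemma branch_inv_end :
  [/\ branch_inv false 0 = 0, branch_inv false 1 = 2^-1,
      branch_inv true 0 = 2^-1 & branch_inv true 1 = 1].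
Proof.
split=> /=; [| |lra|lra].
- by rewrite -[X in left_inv X](left_map0 a) left_invK//; lra.
- by rewrite -[X in left_inv X](left_map_half a) left_invK//; lra.
Qed.

Lemma word_inv_zeros0 k : word_inv (nseq k false) 0 = 0.
Proof. by elim: k => //= k ->; have [] := branch_inv_end. Qed.

Lemma word_inv_ones1 k : word_inv (nseq k true) 1 = 1.
Proof. by elim: k => //= k ->; lra. Qed.

Lemma word_inv_ones0 k : word_inv (nseq k true) 0 = 1 - 2^-1 ^+ k.
Proof. by elim: k => [|k /= ->]; rewrite ?expr0 ?exprS /=; lra. Qed.

Lemma word_len_nil : word_len [::] = 1.
Proof. by rewrite /word_len /= subr0. Qed.

Lemma word_len_zeros k : word_len (nseq k false) = zero_len k.
Proof. by rewrite /word_len word_inv_zeros0 subr0. Qed.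

Lemma zero_len01 k : 0 <= zero_len k <= 1.
Proof. by apply: word_inv_itv => //; rewrite ler01 lexx. Qed.

Lemma word_inv_le w x y : 0 <= x -> x <= y -> y <= 1 ->
  word_inv w x <= word_inv w y.
Proof.
move=> x0 xy y1; have [D [D0 DG _]] := LSV_cone_word a0 a1 w.
have := DG x y x0 xy y1; have := D0 y ltac:(lra); nra.
Qed.

Lemma word_len_ge0 w : 0 <= word_len w.
Proof. by rewrite subr_ge0 word_inv_le. Qed.

Lemma word_lenD w :
  word_len (rcons w false) + word_len (rcons w true) = word_len w.
Proof.
rewrite /word_len !word_inv_rcons /comp.
by have [-> -> -> ->] := branch_inv_end; ring.
Qed.

Lemma half_expr01 k : 0 <= (2^-1 : R) ^+ k <= 1.
Proof. by rewrite exprn_ge0//= exprn_ile1//; lra. Qed.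

(** The density is nonincreasing, so the last part of the unit interval carries
    at most its share of the mass. *)
Lemma word_len_ones_le w k :
  word_len (w ++ nseq k true) <= 2^-1 ^+ k * word_len w.
Proof.
rewrite /word_len !word_inv_cat /comp word_inv_ones1 word_inv_ones0.
have [D [D0 DG _]] := LSV_cone_word a0 a1 w.
have := half_expr01 k; set s := _ ^+ k => s01.
have := DG (1 - s) 1 ltac:(lra) ltac:(lra) ltac:(lra).
have := DG 0 (1 - s) ltac:(lra) ltac:(lra) ltac:(lra).
have := D0 (1 - s) ltac:(lra); nra.
Qed.

(** The density is nonincreasing, so an initial part of the unit interval
    carries at least its share of the mass. *)
Lemma word_len_zeros_ge w k :
  zero_len k * word_len w <= word_len (w ++ nseq k false).
Proof.
rewrite /word_len !word_inv_cat /comp word_inv_zeros0 -/(zero_len k).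
have [D [D0 DG _]] := LSV_cone_word a0 a1 w.
have := zero_len01 k; set s := zero_len k => s01.
have := DG s 1 ltac:(lra) ltac:(lra) ltac:(lra).
have := DG 0 s ltac:(lra) ltac:(lra) ltac:(lra).
have := D0 s ltac:(lra); nra.
Qed.

(** A fresh run of zeros sits just to the right of [1 / 2], where a
    nonincreasing density is at most twice its mean, hence no singularity at [0]
    is felt.  No such bound holds without the leading digit [true]. *)
Lemma word_len_one_zeros_le w k :
  word_len (w ++ true :: nseq k false) <= zero_len k * word_len w.
Proof.
rewrite /word_len !word_inv_cat /comp.
have E x : word_inv (true :: nseq k false) x = (1 + word_inv (nseq k false) x) / 2.
  by [].
rewrite !E word_inv_zeros0 -/(zero_len k).
have [D [D0 DG _]] := LSV_cone_word a0 a1 w.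
have := zero_len01 k; set s := zero_len k => s01.
have := DG ((1 + 0) / 2) ((1 + s) / 2) ltac:(lra) ltac:(lra) ltac:(lra).
have := DG 0 ((1 + 0) / 2) ltac:(lra) ltac:(lra) ltac:(lra).
have := DG ((1 + 0) / 2) 1 ltac:(lra) ltac:(lra) ltac:(lra).
have := D0 1 ltac:(lra).
have := D0 ((1 + 0) / 2) ltac:(lra); nra.
Qed.

(** Here the distortion bound is needed: the density at [1] is at least a
    quarter of the one at [1 / 2].  The comparison is with the cylinder
    [rcons w true] because after a long run of zeros a run of ones is much less
    likely. *)
Lemma word_len_ones_ge w k : (0 < k)%N ->
  2^-1 ^+ k.+1 * word_len (rcons w true) <= word_len (w ++ nseq k true).
Proof.
move=> k0; rewrite /word_len word_inv_rcons !word_inv_cat /comp.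
have [_ _ -> ->] := branch_inv_end; rewrite word_inv_ones1 word_inv_ones0.
have [D [D0 DG Dm]] := LSV_cone_word a0 a1 w.
have sh : (2^-1 : R) ^+ k <= 2^-1.
  by case: k k0 => // k _; rewrite exprS; have := half_expr01 k; lra.
have := half_expr01 k; rewrite exprS; set s := _ ^+ k in sh * => s01.
have := DG (1 - s) 1 ltac:(lra) ltac:(lra) ltac:(lra).
have := DG 2^-1 1 ltac:(lra) ltac:(lra) ltac:(lra).
have := Dm 2^-1 1 ltac:(lra) ltac:(lra) ltac:(lra).
have := D0 1 ltac:(lra); nra.
Qed.

(** The lengths [c k] of the cylinders of [k] zeros satisfy
    [c k = c k.+1 * (1 + s k.+1)] with [s k = (2 * c k) `^ a].  Then [1 / s k]
    grows by an amount between [a / 3] and [a] at each step, which gives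
    [c k] of order [k `^ (- 1 / a)]: see [zero_len_powR_ge] and
    [zero_len_powR_le]. *)
Lemma zero_lenS k : left_map (zero_len k.+1) = zero_len k.
Proof. by have [] := left_invP a0 (zero_len01 k). Qed.

Lemma zero_lenS_le k : 0 <= zero_len k.+1 <= 2^-1.
Proof. by have [] := left_invP a0 (zero_len01 k). Qed.

Lemma zero_len_gt0 k : 0 < zero_len k.
Proof.
elim: k => [|k IH]; first by rewrite /zero_len /=.
have := zero_lenS_le k; have := zero_lenS k.
have [->|n0 _] := eqVneq (zero_len k.+1) 0; last by rewrite lt0r n0 => /andP[].
by rewrite left_map0 => e; move: IH; rewrite -e ltxx.
Qed.

Lemma zero_len0 : zero_len 0 = 1. Proof. by []. Qed.

Let s k := (2 * zero_len k) `^ a.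

Let s_gt0 k : 0 < s k.
Proof. by apply: powR_gt0; have := zero_len_gt0 k; lra. Qed.

Let sS_le1 k : s k.+1 <= 1.
Proof. by apply: (dbl_powR_le1 a0); exact: zero_lenS_le. Qed.

Let sS k : s k = s k.+1 * (1 + s k.+1) `^ a.
Proof.
rewrite {1}/s -zero_lenS left_mapE//; last by case/andP: (zero_lenS_le k).
rewrite mulrA powRM//; first by have := zero_len_gt0 k.+1; lra.
by have := s_gt0 k.+1; rewrite /s; lra.
Qed.

Lemma zero_len_powR_ge k : 1 <= (2 * zero_len k) `^ a * (a * k%:R + 1).
Proof.
have [ha hb] := (a0, a1).
rewrite -/(s k); elim: k => [|k IH].
  rewrite mulr0 add0r mulr1 /s zero_len0 mulr1 -[leLHS](powRr0 2).
  by rewrite ler_powR//; lra.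
move: IH; rewrite sS -(natr1 k); have := s_gt0 k.+1; set t := s k.+1 => t0.
have := @powR_le_affine R a (1 + t) ltac:(lra) ltac:(lra) => h IH.
have {h IH} : 1 <= t * (1 + a * t) * (a * k%:R + 1).
  apply: (le_trans IH); rewrite ler_wpM2r//.
    by rewrite addr_ge0// mulr_ge0//; lra.
  by rewrite ler_pM2l//; lra.
have p1 : 0 < 1 + a * t by nra.
move=> h.
have h1 : (1 + a * t)^-1 <= t * (a * k%:R + 1).
  rewrite -[leLHS]mul1r ler_pdivrMr//; lra.
have h2 : 1 - a * t <= (1 + a * t)^-1.
  by rewrite -[leRHS]mul1r ler_pdivlMr//; nra.
lra.
Qed.

Lemma zero_len_powR_le k : (2 * zero_len k) `^ a * (a * k%:R / 3) <= 1.
Proof.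
have [ha hb] := (a0, a1).
rewrite -/(s k); elim: k => [|k IH]; first by rewrite mulr0 mul0r mulr0.
move: IH; rewrite sS -(natr1 k).
have := sS_le1 k; have := s_gt0 k.+1; set t := s k.+1 => t0 t1.
have q0 : 0 < (1 + t) `^ a by apply: powR_gt0; lra.
(* The affine bound is applied to the inverse [p] of [1 + t]. *)
have h : 1 + a * t / 2 <= (1 + t) `^ a.
  have i0 : 0 < (1 + t)^-1 by rewrite invr_gt0; lra.
  have i1 : (1 + t)^-1 * (1 + t) = 1 by rewrite mulVf// gt_eqF//; lra.
  have := @powR_le_affine R a (1 + t)^-1 ltac:(lra) (ltW i0).
  have : (1 + t)^-1 `^ a * (1 + t) `^ a = 1 by rewrite -powRM ?i1 ?powR1//; lra.
  move: i0 i1 q0; set p := _^-1; set q := _ `^ a; set r := _ `^ a.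
  move=> i0 i1 r0 qr qle.
  have p2 : p * t = 1 - p by lra.
  have ple : p >= 1 / 2 by nra.
  have atp : 0 <= a * t * (p - 1 / 2) by rewrite !mulr_ge0//; lra.
  have atp' : a * (p - 1) = - (a * t * p) by rewrite -mulrA [t * p]mulrC p2; ring.
  have {}qle : r <= 1 - a * t / 2 by lra.
  have b0 : 0 < 1 - a * t / 2 by nra.
  have h1 : 1 <= (1 - a * t / 2) * q by rewrite -[leLHS]qr ler_wpM2r//; lra.
  have sq : 0 <= (a * t / 2) ^+ 2 by exact: sqr_ge0.
  rewrite -(ler_pM2l b0); lra.
have k0 : 0 <= (k%:R : R) by [].
move: k0; set m := k%:R; set q := _ `^ a in q0 h * => m0 IH.
have {}IH : t * (1 + a * t / 2) * (a * m / 3) <= 1.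
  apply: (le_trans _ IH); rewrite ler_wpM2r//.
    by rewrite divr_ge0// mulr_ge0//; lra.
  by rewrite ler_pM2l.
have b0 : 0 < 1 + a * t / 2 by nra.
have e : t * (a * m / 3) <= (1 + a * t / 2)^-1.
  by rewrite -[leRHS]mul1r ler_pdivlMr//; lra.
have e2 : (1 + a * t / 2)^-1 <= 1 - a * t / 3.
  have at0 : 0 <= a * t by rewrite mulr_ge0//; lra.
  have at1 : a * t <= 1 by nra.
  have at2 : 0 <= a * t * (1 - a * t) by rewrite mulr_ge0//; lra.
  by rewrite -[leLHS]mul1r ler_pdivrMr//; lra.
lra.
Qed.

Lemma zero_len_le_of (Y : R) k : 0 < Y -> Y `^ a <= k%:R ->
  zero_len k <= (3 / a) `^ a^-1 / Y.
Proof.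
move=> Y0 Yk; have ha := a0; have Ya := powR_gt0 a Y0.
have k0 : 0 < (k%:R : R) by lra.
have c0 := zero_len_gt0 k.
have h : (zero_len k * Y) `^ a <= 3 / a.
  rewrite powRM//; [|lra..].
  have := zero_len_powR_le k; rewrite powRM//; [|lra..].
  have t1 : 1 <= 2 `^ a :> R by rewrite -[leLHS](powRr0 2) ler_powR//; lra.
  have z0 := powR_gt0 a c0.
  move: (_ `^ a) (_ `^ a) (_ `^ a) Yk t1 z0 Ya => x y z Yk t1 z0 Ya h.
  rewrite ler_pdivlMr//.
  apply: (@le_trans _ _ (y * x * (a * k%:R / 3) * 3)); last by lra.
  rewrite (_ : _ * 3 = y * (x * a * k%:R)); last by field.
  apply: (@le_trans _ _ (x * a * k%:R)).
    by rewrite -!mulrA ler_pM2l// mulrC ler_pM2l.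
  by rewrite ler_peMl// !mulr_ge0//; lra.
rewrite ler_pdivlMr//.
have zY : 0 <= zero_len k * Y by rewrite mulr_ge0//; lra.
rewrite -[leLHS]powRr1// -[X in _ `^ X <= _](@divff _ a) ?gt_eqF// powRrM.
by apply: ge0_ler_powR; rewrite ?nnegrE ?invr_ge0 ?divr_ge0 ?powR_ge0//; (exact: ltW || lra).
Qed.

Lemma zero_len_ge_of (Y : R) k : 1 <= Y -> k%:R <= Y `^ a ->
  2^-1 `^ a^-1 / 2 / Y <= zero_len k.
Proof.
move=> Y1 Yk; have [ha hb] := (a0, a1).
have c0 := zero_len_gt0 k.
have Ya : 1 <= Y `^ a.
  have e1 : 1 `^ a = 1 :> R by rewrite powR1.
  by rewrite -[leLHS]e1; apply: ge0_ler_powR; rewrite ?nnegrE; (exact: ltW || lra).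
rewrite -mulrA -invfM ler_pdivrMr ?mulr_gt0//; last lra.
have h : 2^-1 <= (zero_len k * (2 * Y)) `^ a.
  rewrite mulrA [_ * 2]mulrC powRM//; [|lra..].
  have := zero_len_powR_ge k.
  have := powR_ge0 (2 * zero_len k) a.
  move: (_ `^ a) (_ `^ a) Yk Ya => x y xk x1 y0 h.
  have k0 : (k%:R : R) >= 0 by [].
  have {}h : 1 <= x * (2 * y) by apply: (le_trans h); rewrite ler_wpM2l//; nra.
  lra.
have zY : 0 <= zero_len k * (2 * Y) by rewrite mulr_ge0//; lra.
rewrite -[leRHS]powRr1// -[X in _ <= _ `^ X](@divff _ a) ?gt_eqF// powRrM.
by apply: ge0_ler_powR; rewrite ?nnegrE ?invr_ge0 ?divr_ge0 ?powR_ge0//; (exact: ltW || lra).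
Qed.

(** A bound for the sum of [zero_len j] over [j >= k], in the form of the mass
    near [0] of a density of order [x `^ (- a)]. *)
Definition zero_tail k : R := 2 / (1 - a) * zero_len k `^ (1 - a).

Lemma zero_len_le_tail k : zero_len k <= zero_tail k.
Proof.
have [ha hb] := (a0, a1).
have c0 := zero_len_gt0 k; have /andP[_ c1] := zero_len01 k.
apply: (@le_trans _ _ (zero_len k `^ (1 - a))).
  rewrite -{1}[zero_len k](@powRr1 R); last lra.
  by apply: ger_powR; lra.
rewrite ler_peMl ?powR_ge0// ler_pdivlMr; lra.
Qed.

(** Since [zero_len k - zero_len k.+1] is [zero_len k.+1 * (2 * zero_len k.+1)
    `^ a], of order [zero_len k `^ (1 + a)], the power [1 - a] of [zero_len]
    decreases by an amount of order [zero_len k]. *)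
Lemma zero_tail_step k : zero_len k + zero_tail k.+1 <= zero_tail k.
Proof.
have [ha hb] := (a0, a1).
have x0 := zero_len_gt0 k.+1; have z0 := zero_len_gt0 k.
have := zero_lenS k; rewrite left_mapE//; last lra.
have := sS_le1 k; rewrite /zero_tail /s.
set x := zero_len k.+1 in x0 *; set z := zero_len k in z0 *.
move=> s1 ez.
have xz0 : 0 < x / z by rewrite divr_gt0.
have := @powR_le_affine R (1 - a) (x / z) ltac:(lra) (ltW xz0).
have xE : x `^ (1 - a) = z `^ (1 - a) * (x / z) `^ (1 - a).
  by rewrite -powRM ?(ltW xz0)//; [rewrite mulrC divfK ?gt_eqF|lra].
rewrite {}xE; move: (_ `^ (1 - a)) => p hp.
have zE : z `^ (1 - a) * z `^ a = z.
  rewrite -powRD; last by rewrite [z == 0]gt_eqF ?implybT.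
  by rewrite subrK powRr1//; lra.
have q0 := powR_gt0 (1 - a) z0.
have zx : z `^ a <= (2 * x) `^ a.
  by apply: ge0_ler_powR; rewrite ?nnegrE; (exact: ltW || nra).
move: zE zx q0 s1 ez; set q := z `^ (1 - a); set t := z `^ a; set r := _ `^ a.
move=> zE zx q0 s1 ez.
have e1 : q * (1 - p) >= (1 - a) * (q * (1 - x / z)).
  by rewrite mulrCA ler_pM2l//; lra.
have e2 : q * (1 - x / z) >= z / 2.
  have -> : 1 - x / z = x * r / z.
    rewrite -[1](@divff _ z) ?gt_eqF// -mulrBl (_ : z - x = x * r)//.
    by rewrite -ez; ring.
  rewrite mulrA ler_pdivlMr//.
  apply: (@le_trans _ _ (q * (x * t))); last by rewrite ler_pM2l// ler_pM2l.
  rewrite [leRHS]mulrCA zE ler_pM2r//; nra.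
have c0 : 0 < 1 - a by lra.
suff : z <= 2 / (1 - a) * (q * (1 - p)) by lra.
apply: (@le_trans _ _ (2 / (1 - a) * ((1 - a) * (z / 2)))).
  rewrite le_eqVlt; apply/orP/or_introl/eqP; field; rewrite gt_eqF//.
by rewrite ler_wpM2l ?divr_ge0//; [lra|nra].
Qed.

Definition code n x : seq bool := [seq ~~ (y < 2^-1) | y <- traject (intermittent a) x n].

Lemma size_code n x : size (code n x) = n.
Proof. by rewrite size_map size_traject. Qed.

Lemma codeP w x : unitI R x ->
  (code (size w) x == w) = (word_inv w 0 <= x < word_inv w 1).
Proof.
elim: w x => [|d w IH] x /[dup] ux; rewrite /unitI/= in_itv/= => /andP[x0 x1].
  by rewrite x0 x1.
have uT := intermittent_unitI a0 ux.
rewrite /code /= eqseq_cons -/(code (size w) (intermittent a x)) IH//.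
have := @word_inv_itv R a a0 w 0 ltac:(lra); have := @word_inv_itv R a a0 w 1 ltac:(lra).
move: (word_inv w 0) (word_inv w 1) => A B B01 A01.
rewrite /intermittent; case: d; rewrite /branch_inv.
  case: ltP => xh /=.
    by apply/esym/negbTE/negP => /andP[]; lra.
  by apply/idP/idP => /andP[? ?]; lra.
have [hA eA] := left_invP a0 A01; have [hB eB] := left_invP a0 B01.
case: ltP => xh /=; last first.
  by apply/esym/negbTE/negP => /andP[]; lra.
rewrite -/(left_map x) -{1}eA -{1}eB.
have lt_iff (p q : R) : 0 <= p -> 0 <= q -> (left_map p < left_map q) = (p < q).
  move=> p0 q0; case: (ltgtP p q) => [pq|qp|->].
  - exact: left_map_lt.
  - by apply/negbTE; rewrite -leNgt ltW// left_map_lt.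
  - by rewrite ltxx.
by rewrite leNgt !lt_iff ?[in RHS]leNgt//; lra.
Qed.
End Words.

(** * Finitely additive mass on binary words *)
Section CylinderMass.
Context {R : realType} (m : seq bool -> R).
Hypothesis m_ge0 : forall w, 0 <= m w.
Hypothesis mD : forall w, m (rcons w false) + m (rcons w true) = m w.
Implicit Types (w u v : seq bool) (f g : seq bool -> R) (P Q : pred (seq bool)).
Implicit Types (n s j k N L : nat).

(** The integral of [f], a function of the [n] digits that follow [w], over the
    cylinder of [w]; it is not normalised by [m w]. *)
Fixpoint expect f n w : R :=
  if n is n'.+1 then
    expect (fun v => f (false :: v)) n' (rcons w false) +
    expect (fun v => f (true :: v)) n' (rcons w true)
  else f [::] * m w.

Definition prob P n w : R := expect (fun v => (P v)%:R) n w.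

Lemma expect_le f g n w : (forall v, size v = n -> f v <= g v) ->
  expect f n w <= expect g n w.
Proof.
elim: n f g w => [|n IH] f g w fg /=; first by rewrite ler_wpM2r// fg.
by rewrite lerD// IH// => v sv; rewrite fg//= sv.
Qed.

Lemma expectD f g n w :
  expect (fun v => f v + g v) n w = expect f n w + expect g n w.
Proof.
by elim: n f g w => [|n IH] f g w /=; rewrite ?mulrDl// !IH; ring.
Qed.

Lemma expectZ (c : R) f n w : expect (fun v => c * f v) n w = c * expect f n w.
Proof.
by elim: n f w => [|n IH] f w /=; rewrite ?mulrA// !IH; ring.
Qed.

Lemma expect_cst (c : R) n w : expect (fun=> c) n w = c * m w.
Proof. by elim: n w => //= n IH w; rewrite !IH -mulrDr mD. Qed.

Lemma expect_sum N (F : nat -> seq bool -> R) n w :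
  expect (fun v => \sum_(s < N) F s v) n w = \sum_(s < N) expect (F s) n w.
Proof.
elim: N => [|N IH].
  rewrite big_ord0; transitivity (expect (fun=> 0) n w).
    by congr expect; apply/funext => v; rewrite big_ord0.
  by rewrite expect_cst mul0r.
rewrite big_ord_recr/= -IH -expectD; congr expect; apply/funext => v.
by rewrite big_ord_recr.
Qed.

Lemma prob_le P Q n w : (forall v, size v = n -> P v -> Q v) ->
  prob P n w <= prob Q n w.
Proof.
move=> PQ; apply: expect_le => v sv.
by rewrite /= ler_nat; case: (P v) (PQ _ sv) => // ->.
Qed.

Lemma prob_ge0 P n w : 0 <= prob P n w.
Proof. by rewrite -(mul0r (m w)) -(expect_cst 0 n); apply: expect_le. Qed.

Lemma prob_le_mass P n w : prob P n w <= m w.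
Proof.
rewrite -[leRHS]mul1r -(expect_cst 1 n).
by apply: expect_le => v _; rewrite /= lern1 leq_b1.
Qed.

Lemma prob_pred0 P n w : (forall v, size v = n -> ~~ P v) -> prob P n w = 0.
Proof.
move=> P0; apply/le_anti; rewrite prob_ge0 andbT.
rewrite -[leRHS](mul0r (m w)) -(expect_cst 0 n); apply: expect_le => v sv.
by rewrite /= (negbTE (P0 _ sv)).
Qed.

Lemma prob_or P Q n w :
  prob (fun v => P v || Q v) n w <= prob P n w + prob Q n w.
Proof.
rewrite /prob -expectD; apply: expect_le => v _.
by rewrite /= -natrD ler_nat; case: (P v); case: (Q v).
Qed.

Lemma prob_markov N (t : nat) (Q : nat -> pred (seq bool)) n w :
  t%:R * prob (fun v => t <= \sum_(s < N) Q s v)%N n w <=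
  \sum_(s < N) prob (Q s) n w.
Proof.
rewrite /prob -expectZ -(@expect_sum N (fun s v => (Q s v)%:R)).
apply: expect_le => v _; rewrite /= -natr_sum -natrM ler_nat.
by case: (leqP t) => h /=; rewrite ?muln1 ?muln0.
Qed.

Lemma prob_prefix u n w : prob (prefix u) n w <= m (w ++ u).
Proof.
elim: u n w => [|b u IH] [|n] w; rewrite ?cats0; try exact: prob_le_mass.
  by rewrite /prob /= mul0r.
rewrite -cat_rcons; apply: le_trans (IH n (rcons w b)).
rewrite /prob /=; case: b.
  rewrite -[leRHS]add0r lerD//.
  by rewrite le_eqVlt; apply/orP/or_introl/eqP/prob_pred0.
rewrite -[leRHS]addr0 lerD//.
by rewrite le_eqVlt; apply/orP/or_introl/eqP/prob_pred0.
Qed.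

(** A bound that holds conditionally on every past holds at every later time. *)
Lemma prob_drop (c : R) P s n w :
  (forall n w, prob P n w <= c * m w) ->
  prob (fun v => P (drop s v)) n w <= c * m w.
Proof.
move=> Pc; elim: s n w => [|s IH] n w.
  by apply: le_trans (Pc n w); apply: prob_le => v _; rewrite drop0.
case: n => [|n]; first exact: Pc 0 w.
by rewrite -mD mulrDr; apply: lerD; apply: IH.
Qed.

Lemma mass_cat_le w u : m (w ++ u) <= m w.
Proof.
elim/last_ind: u => [|u b IH]; first by rewrite cats0.
rewrite -rcons_cat; apply: le_trans IH; rewrite -[leRHS]mD.
by case: b; rewrite ?lerDr ?lerDl.
Qed.

Lemma mass_nseq_le w b j k : (j <= k)%N -> m (w ++ nseq k b) <= m (w ++ nseq j b).
Proof. by move=> /subnKC <-; rewrite nseqD catA mass_cat_le. Qed.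

(** Zeros at time [s.+1] either follow a one at time [s], which has mass at most
    [c k], or belong to a run of [k.+1] zeros at time [s].  Hence the mass of
    [k] zeros at time [s] is at most the sum of the [c j] for [k <= j], whatever
    [s] is; [b] is any bound for that tail. *)
Lemma prob_zero_window (c b : nat -> R) s k n :
  (forall w k, m (w ++ true :: nseq k false) <= c k * m w) ->
  (forall k, m (nseq k false) <= c k) -> m [::] = 1 ->
  (forall k, c k + b k.+1 <= b k) -> (forall k, c k <= b k) ->
  (0 < k)%N ->
  prob (fun v => prefix (nseq k false) (drop s v)) n [::] <= b k.
Proof.
move=> mc mc0 m1 cb cleb; elim: s k => [|s IH] k k0.
  apply: le_trans (cleb k); apply: le_trans (mc0 k).
  rewrite -[nseq k false as X in m X]cat0s.
  apply: le_trans (prob_prefix _ n _).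
  by apply: prob_le => v _; rewrite drop0.
apply: le_trans (cb k).
apply: (@le_trans _ _ (prob (fun v => prefix (true :: nseq k false) (drop s v)) n [::]
    + prob (fun v => prefix (nseq k.+1 false) (drop s v)) n [::])).
  apply: le_trans (prob_or _ _ _ _); apply: prob_le => v _.
  rewrite -addn1 addnC -drop_drop.
  case: (drop s v) => [|d v'] /=; first by case: k k0.
  by rewrite drop0; case: d => ->.
apply: lerD; last exact: IH.
have := @prob_drop (c k) (prefix (true :: nseq k false)) s n [::].
by rewrite m1 mulr1; apply => n' w; apply: le_trans (mc w k); apply: prob_prefix.
Qed.

Lemma prob_some_window (c : R) u N n :
  (forall w, m (w ++ u) <= c * m w) ->
  prob (fun v => 0 < \sum_(s < N) prefix u (drop s v))%N n [::] <=
    N%:R * (c * m [::]).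
Proof.
move=> mc.
have := @prob_markov N 1 (fun s v => prefix u (drop s v)) n [::].
rewrite mul1r => /le_trans; apply.
apply: (@le_trans _ _ (\sum_(s < N) c * m [::])).
  apply: ler_sum => s _; apply: (@prob_drop c (prefix u)) => n' w.
  by apply: le_trans (mc w); apply: prob_prefix.
by rewrite sumr_const card_ord mulr_natl.
Qed.

(** The state [j] is the length of the run under way; carrying it makes induction
    on the digits possible. *)
Fixpoint norun b k j v : bool :=
  if v is d :: v' then
    if d == b then (j.+1 < k)%N && norun b k j.+1 v' else norun b k 0 v'
  else true.

Lemma norun_infix b k j v : ~~ norun b k j v -> infix (nseq k b) (nseq j b ++ v).
Proof.
elim: v j => //= d v IH j; case: eqP => [->|_].
  have -> : nseq j b ++ b :: v = nseq j.+1 b ++ v.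
    by rewrite -cat_rcons -cats1 -(nseqD j 1 b) addn1.
  rewrite negb_and => /orP[|/IH//]; rewrite -leqNgt => /subnKC <-.
  by rewrite nseqD -catA prefix_infix.
by move=> /IH h; rewrite -cat_rcons infix_catl.
Qed.

(** Every one starts a new trial for a run of zeros, which succeeds with
    conditional probability at least [p] whatever the past; the initial position
    counts as a trial as well.  In state [j] the current trial may still fail
    only on [m (w ++ nseq j false) - m (w ++ nseq k false)]. *)
Lemma zero_trials (p : R) k N n : 0 <= p <= 1 -> (0 < k)%N ->
  (forall w, p * m w <= m (w ++ nseq k false)) ->
  prob (fun v => norun false k 0 v && (N < count id v)%N) n [::] <=
    (1 - p) ^+ N.+1 * m [::].
Proof.
move=> /andP[p0 p1] k0 mp.
have q0 N' : 0 <= (1 - p) ^+ N' by rewrite exprn_ge0// subr_ge0.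
have mp' w : m w - m (w ++ nseq k false) <= (1 - p) * m w.
  by have := mp w; rewrite mulrBl mul1r; lra.
suff main j w : (j < k)%N ->
    prob (fun v => norun false k j v && (N < count id v)%N) n (w ++ nseq j false) <=
    (1 - p) ^+ N * (m (w ++ nseq j false) - m (w ++ nseq k false)).
  have := main 0%N [::] k0; rewrite cats0 => /le_trans; apply.
  by rewrite exprSr -mulrA ler_wpM2l.
elim: n N j w => [|n IH] N j w jk.
  rewrite prob_pred0// => [|v /size0nil -> //].
  by rewrite mulr_ge0// subr_ge0 mass_nseq_le// ltnW.
have -> : m (w ++ nseq j false) - m (w ++ nseq k false) =
    (m (rcons (w ++ nseq j false) false) - m (w ++ nseq k false)) +
    m (rcons (w ++ nseq j false) true).
  by rewrite -(mD (w ++ nseq j false)); ring.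
rewrite mulrDr /prob /=; apply: lerD.
  have -> : rcons (w ++ nseq j false) false = w ++ nseq j.+1 false.
    by rewrite -cats1 -catA -(nseqD j 1 false) addn1.
  case: ltnP => [jk'|kj]; first exact: IH.
  rewrite -/(prob (fun v => false && _) n _) prob_pred0//.
  by rewrite mulr_ge0// subr_ge0 mass_nseq_le.
set w' := rcons _ true; case: N => [|N].
  by rewrite expr0 mul1r; apply: prob_le_mass.
have := IH N 0%N w' k0; rewrite cats0 => /le_trans; apply.
by rewrite exprSr -mulrA ler_wpM2l.
Qed.

(** A trial for a run of ones consumes up to [K] ones before it fails, whence
    the [K]-th root [q] of the failure probability, paid for each one.  The
    factor [q ^+ K] in the denominators accounts for a last trial that the
    [n] digits leave unfinished: a bound on the state [j] is claimed only
    while enough ones are still due for the trial to end. *)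
Lemma one_trials (p q : R) K N n w : 0 < q <= 1 -> 1 - p <= q ^+ K -> (0 < K)%N ->
  (forall w, p * m (rcons w true) <= m (w ++ nseq K true)) ->
  prob (fun v => norun true K 0 v && (N <= count id v)%N) n w <=
    q ^+ N / q ^+ K * m w.
Proof.
move=> /andP[q0 q1] pq K0 mp.
have qn0 i : 0 < q ^+ i by rewrite exprn_gt0.
have qle i j : (i <= j)%N -> q ^+ j <= q ^+ i.
  by move=> ij; rewrite ler_wiXn2l// ltW.
suff main : (forall N w,
    prob (fun v => norun true K 0 v && (N <= count id v)%N) n w <=
    q ^+ N / q ^+ K * m w) /\
  (forall N j w, (j < K)%N -> (K <= N + j)%N ->
    prob (fun v => norun true K j v && (N <= count id v)%N) n (w ++ nseq j true) <=
    q ^+ (N + j) / q ^+ (K + K) * (m (w ++ nseq j true) - m (w ++ nseq K true))).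
  by case: main.
have triv N' n' w' P : (N' <= K)%N -> prob P n' w' <= q ^+ N' / q ^+ K * m w'.
  move=> NK; apply: (le_trans (prob_le_mass _ _ _)).
  by rewrite ler_peMl// ler_pdivlMr// mul1r qle.
elim: n {N w} => [|n [IHw IHt]].
  split=> [N w|N j w jK KN].
    have [NK|KN] := leqP N K; first exact: triv.
    rewrite prob_pred0 => [|v /size0nil -> /=].
      by rewrite mulr_ge0// divr_ge0// ltW.
    by rewrite -ltnNge (leq_trans _ KN).
  rewrite prob_pred0 => [|v /size0nil -> /=]; last first.
    by rewrite -ltnNge; lia.
  by rewrite mulr_ge0 ?divr_ge0 ?(ltW (qn0 _))// subr_ge0 mass_nseq_le// ltnW.
split=> [N w|N j w jK KN].
  have [NK|KN] := leqP N K; first exact: triv.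
  rewrite -[in leRHS]mD mulrDr /prob /=; apply: lerD; first exact: IHw.
  case: ltnP => K1; last first.
    rewrite -/(prob (fun v => false && _) n _) prob_pred0//.
    by rewrite mulr_ge0// divr_ge0// ltW.
  case: N KN => // N KN.
  have := IHt N 1%N w K1; rewrite addn1 cats1 => /(_ (ltnW KN)) /le_trans; apply.
  apply: (@le_trans _ _ (q ^+ N.+1 / q ^+ (K + K) * (q ^+ K * m (rcons w true)))).
    rewrite ler_wpM2l ?divr_ge0 ?(ltW (qn0 _))//.
    have := mp w; have := ler_wpM2r (m_ge0 (rcons w true)) pq; lra.
  rewrite [q ^+ (K + K)]exprD le_eqVlt; apply/orP/or_introl/eqP.
  by have := qn0 K; move: (q ^+ K) => C C0; field; rewrite gt_eqF.
have -> : m (w ++ nseq j true) - m (w ++ nseq K true) =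
    m (rcons (w ++ nseq j true) false) +
    (m (w ++ nseq j.+1 true) - m (w ++ nseq K true)).
  rewrite addrA -[in LHS]mD; congr (_ + m _ - _).
  by rewrite -cats1 -catA -(nseqD j 1 true) addn1.
rewrite mulrDr /prob [expect _ n.+1 _]/=; apply: lerD.
  apply: (le_trans (IHw _ _)); rewrite ler_wpM2r//.
  rewrite [q ^+ (K + K)]exprD [q ^+ (N + j)]exprD.
  have := qle j K (ltnW jK); have := qn0 K; have := qn0 N.
  move: (q ^+ K) (q ^+ N) (q ^+ j) => C A B A0 C0 CB.
  rewrite ler_pdivrMr// (_ : A * B / (C * C) * C = A * (B / C)); last first.
    by field; rewrite gt_eqF.
  by rewrite ler_peMr ?(ltW A0)// ler_pdivlMr// mul1r.
have -> : rcons (w ++ nseq j true) true = w ++ nseq j.+1 true.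
  by rewrite -cats1 -catA -(nseqD j 1 true) addn1.
case: ltnP => jK'; last first.
  rewrite -/(prob (fun v => false && _) n _) prob_pred0//.
  by rewrite mulr_ge0 ?divr_ge0 ?(ltW (qn0 _))// subr_ge0 mass_nseq_le.
case: N KN => [|N] KN; first by lia.
by rewrite addSnnS; apply: IHt => //; lia.
Qed.

End CylinderMass.

(** Each window of length [L] that is not all zeros contains a one, and each one
    belongs to at most [L] windows. *)
Lemma count_ge_windows n L v : (n + L <= size v)%N ->
  (\sum_(s < n) ~~ prefix (nseq L false) (drop s v) <= L * count id v)%N.
Proof.
have cnt u k : (\sum_(s < k) nth false u s <= count id u)%N.
  elim: u k => [|b u IH] [|k]; rewrite ?big_ord0//=.
    by rewrite big1// => i _; rewrite nth_nil.
  by rewrite big_ord_recl leq_add2l; exact: IH.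
have win u : (L <= size u)%N ->
    (~~ prefix (nseq L false) u <= \sum_(t < L) nth false u t)%N.
  elim: L u => [|L' IH] u; first by rewrite prefix0s.
  case: u => // b u; rewrite /= ltnS => Lu; rewrite big_ord_recl/=.
  by case: b => //=; rewrite add0n; exact: IH.
move=> nL; apply: (@leq_trans (\sum_(s < n) \sum_(t < L) nth false v (s + t))).
  apply: leq_sum => s _; have := win (drop s v).
  rewrite size_drop => /(_ _) h; apply: leq_trans (h _) _.
    by have := ltn_ord s; lia.
  by apply: leq_sum => t _; rewrite nth_drop.
rewrite exchange_big/= -[L in (L * _)%N]card_ord -sum_nat_const.
apply: leq_sum => t _; apply: (@leq_trans (count id (drop t v))).
  apply: leq_trans (cnt (drop t v) n); apply: leq_sum => s _.
  by rewrite nth_drop addnC.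
by rewrite -[in leqRHS](cat_take_drop t v) count_cat leq_addl.
Qed.

(** Extending a run of zeros to the left ends at a one or at the origin.  This
    reduces runs of zeros to fresh ones, for which [word_len_one_zeros_le] is
    available. *)
Lemma first_zero_run k s v : (0 < k)%N -> prefix (nseq k false) (drop s v) ->
  prefix (nseq k false) v \/
  exists2 s', (s' < s)%N & prefix (true :: nseq k false) (drop s' v).
Proof.
move=> k0; elim: s => [|s IH]; first by rewrite drop0; left.
rewrite -addn1 addnC -drop_drop; case e : (drop s v) => [|d u].
  by case: k k0 {IH}.
rewrite /= drop0 => pu; case: d e => e.
  by right; exists s; [rewrite add1n|rewrite e].
have /IH [pv|[s' ss' ps']] : prefix (nseq k false) (drop s v).
  rewrite e; apply: prefix_trans (_ : prefix (nseq k.+1 false) _).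
    by rewrite -addn1 nseqD prefix_prefix.
  by rewrite /= pu.
- by left.
- by right; exists s' => //; rewrite add1n ltnS ltnW.
Qed.

(** * Lebesgue measure of digit events *)
Section CodeEvents.
Context {R : realType} (a : R).
Hypotheses (a0 : 0 < a) (a1 : a < 1).
Implicit Types (w u v : seq bool) (P : pred (seq bool)) (n s k : nat) (x : R).

Local Notation leb := (@lebesgue_measure R).
Local Notation len := (word_len a).
Local Notation code := (code a).

Definition code_event P n w : set (measurableTypeR R) :=
  [set x | unitI R x /\
    (take (size w) (code (size w + n) x) == w) &&
    P (drop (size w) (code (size w + n) x))].

(** Only this inequality links the word masses to the Lebesgue measure. *)
Lemma code_event_measure P n w : measurable (code_event P n w) /\
  (leb (code_event P n w) <= (prob len P n w)%:E)%E.
Proof.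
elim: n P w => [|n IH] P w.
  have [P0|nP0] := boolP (P [::]); last first.
    have -> : code_event P 0 w = set0.
      rewrite -subset0 => x [_] /andP[_].
      by rewrite addn0 drop_oversize ?size_code// (negbTE nP0).
    by rewrite measure0 lee_fin (prob_ge0 (word_len_ge0 a0 a1) (word_lenD a0)).
  have -> : code_event P 0 w = `[word_inv a w 0, word_inv a w 1[%classic.
    have w0 : 0 <= word_inv a w 0 <= 1 by apply: word_inv_itv => //; rewrite lexx ler01.
    have w1 : 0 <= word_inv a w 1 <= 1 by apply: word_inv_itv => //; rewrite lexx ler01.
    apply/seteqP; split=> x; rewrite /code_event/= in_itv/= addn0.
      rewrite take_oversize ?size_code// => -[ux /andP[cw _]].
      by move: cw; rewrite codeP.
    move=> xw.
    have ux : unitI R x by rewrite /unitI/= in_itv/=; case/andP: xw; lra.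
    by rewrite take_oversize ?drop_oversize ?size_code// codeP// xw P0.
  split; first exact: measurable_itv.
  rewrite lebesgue_measure_itv/= lte_fin /prob/= P0 mul1r /word_len.
  by case: ltP => // h; rewrite lee_fin (word_len_ge0 a0 a1).
have -> : code_event P n.+1 w =
    code_event (fun v => P (false :: v)) n (rcons w false) `|`
    code_event (fun v => P (true :: v)) n (rcons w true).
  have E d x : (take (size (rcons w d)) (code (size (rcons w d) + n) x) == rcons w d) &&
      P (d :: drop (size (rcons w d)) (code (size (rcons w d) + n) x)) =
      [&& nth false (code (size w + n.+1) x) (size w) == d,
      (take (size w) (code (size w + n.+1) x) == w) &
      P (drop (size w) (code (size w + n.+1) x))].
    rewrite size_rcons addSnnS; set c := code _ _.
    have sc : (size w < size c)%N by rewrite size_code; lia.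
    rewrite (take_nth false)// eqseq_rcons [drop (size w) c](drop_nth false)//.
    by case: (nth false c (size w) =P d) => [->|_]; rewrite ?andbT ?andbF.
  apply/seteqP; split=> x; rewrite /code_event/=.
    move=> [ux h]; case b : (nth false (code (size w + n.+1) x) (size w)).
      by right; split=> //; rewrite (E true) b.
    by left; split=> //; rewrite (E false) b.
  by move=> [] [ux]; rewrite E => /andP[_].
have [mF lF] := IH (fun v => P (false :: v)) (rcons w false).
have [mT lT] := IH (fun v => P (true :: v)) (rcons w true).
split; first exact: measurableU.
apply: le_trans (measureU2 leb mF mT) _.
by rewrite /prob /= EFinD; apply: leeD.
Qed.

(** The first Borel-Cantelli lemma for events that depend on finitely many
    digits. *)
Lemma code_borel_cantelli (P : nat -> pred (seq bool)) (N : nat -> nat) (C r : R) :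
  0 <= r < 1 -> (forall i, prob len (P i) (N i) [::] <= C * r ^+ i) ->
  {ae leb, forall x : R, unitI R x ->
    exists i0, forall i, (i0 <= i)%N -> ~~ P i (code (N i) x)}.
Proof.
move=> /andP[r0 r1] Pr; pose F i := code_event (P i) (N i) [::].
have mF i : measurable (F i) by case: (code_event_measure (P i) (N i) [::]).
have lF i : (leb (F i) <= (C * r ^+ i)%:E)%E.
  case: (code_event_measure (P i) (N i) [::]) => _ /le_trans; apply.
  by rewrite lee_fin.
exists (lim_sup_set F); split.
- by apply: bigcap_measurable => // n _; apply: bigcup_measurable => j _; exact: mF.
- apply: lim_sup_set_cvg0 => //.
  apply: (@le_lt_trans _ _ (C / (1 - r))%:E); last exact: ltry.
  apply: lime_le; first by apply: is_cvg_nneseries.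
  apply: nearW => n.
  have C0 : 0 <= C.
    have := Pr 0%N; rewrite expr0 mulr1; apply: le_trans.
    exact: prob_ge0 (word_len_ge0 a0 a1) (word_lenD a0) _ _ _.
  apply: (@le_trans _ _ (C / (1 - r) * (1 - r ^+ n))%:E); last first.
    rewrite lee_fin ler_piMr//; first by rewrite divr_ge0//; lra.
    by have := exprn_ge0 n r0; lra.
  elim: n => [|n IH]; first by rewrite big_nil expr0 subrr mulr0.
  rewrite big_nat_recr//=; apply: (le_trans (leeD IH (lF n))).
  rewrite -EFinD lee_fin le_eqVlt; apply/orP/or_introl/eqP.
  by rewrite exprS; field; lra.
- move=> x /= nx n _; apply: contrapT => nF; apply: nx => ux.
  exists n => i ni; apply/negP => Pi; apply: nF; exists i => //.
  by split=> //; rewrite take0 drop0.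
Qed.

End CodeEvents.

(** * Runs of digits as windows of the digit word *)
Section MaxRun.
Context {R : realType} (a : R).
Implicit Types (u : seq bool) (n s k : nat) (x : R).

Local Notation code := (code a).

Lemma nth_code n x s : (s < n)%N -> nth false (code n x) s = ~~ (iter s (intermittent a) x < 2^-1).
Proof.
by move=> sn; rewrite (nth_map x) ?size_traject// nth_traject.
Qed.

Lemma prefix_nseq k b u : (k <= size u)%N ->
  prefix (nseq k b) u = [forall j : 'I_k, nth false u j == b].
Proof.
move=> ku; rewrite prefixE size_nseq; apply/eqP/forallP => [e j|h].
  by rewrite -(nth_take _ (ltn_ord j)) e nth_nseq ltn_ord.
apply: (@eq_from_nth _ false) => [|j]; rewrite ?size_takel ?size_nseq// => jk.
by rewrite nth_take// nth_nseq jk; apply/eqP; exact: h (Ordinal jk).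
Qed.

Lemma window_digits (b : bool) n x s k : (s + k <= n)%N ->
  [forall j : 'I_k, digit a (s + j.+1) x == b] = prefix (nseq k b) (drop s (code n x)).
Proof.
move=> skn; rewrite prefix_nseq; last by rewrite size_drop size_code; lia.
apply: eq_forallb => j; rewrite nth_drop nth_code; last by have := ltn_ord j; lia.
by rewrite /digit addnS/=; case: ifP; case: b.
Qed.

Lemma max_run_ge (b : bool) n x k :
  infix (nseq k b) (code n x) -> (k <= max_run a b n x)%N.
Proof.
move=> /infixP[p [q e]].
have skn : (size p + k <= n)%N.
  by rewrite -(size_code a n x) e !size_cat size_nseq addnA leq_addr.
have kn : (k < n.+1)%N by rewrite ltnS (leq_trans (leq_addl _ _) skn).
have pn : (size p < n.+1)%N by rewrite ltnS (leq_trans (leq_addr _ _) skn).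
apply: (@leq_bigmax_cond _ _ (fun k : 'I_n.+1 => nat_of_ord k) (Ordinal kn)).
apply/existsP; exists (Ordinal pn) => /=.
rewrite skn andTb (window_digits b x skn).
by rewrite e drop_size_cat// prefix_prefix.
Qed.

Lemma max_run_window (b : bool) n x k : (k <= max_run a b n x)%N ->
  exists2 s, (s + k <= n)%N & prefix (nseq k b) (drop s (code n x)).
Proof.
pose A : pred 'I_n.+1 := fun k : 'I_n.+1 => [exists i : 'I_n.+1, (i + k <= n)%N &&
  [forall j : 'I_k, digit a (i + j.+1) x == b]].
have -> : max_run a b n x = (\max_(i in A) i)%N by [].
have A0 : (0 < #|A|)%N.
  apply/card_gt0P; exists ord0; rewrite unfold_in; apply/existsP; exists ord0.
  by by apply/andP; split=> //; apply/forallP => -[].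
have [k0 Ak0 ->] := @eq_bigmax_cond _ A (fun k : 'I_n.+1 => nat_of_ord k) A0.
move: Ak0; rewrite unfold_in => /existsP[s /andP[sk0]].
rewrite (window_digits b x sk0) => pk0 kk0.
exists s; first by rewrite (leq_trans _ sk0)// leq_add2l.
apply: prefix_trans pk0; move: kk0 => /subnKC <-.
by rewrite nseqD prefix_prefix.
Qed.

Lemma code_prefix n n' x : (n <= n')%N -> prefix (code n x) (code n' x).
Proof.
elim: n n' x => [|n IH] [|n'] x//.
by rewrite ltnS => /IH h; rewrite /code /= eqxx; exact: h.
Qed.

Lemma max_run_le (b : bool) n n' x : (n <= n')%N ->
  (max_run a b n x <= max_run a b n' x)%N.
Proof.
move=> nn'; have [s sk ps] := max_run_window (leqnn (max_run a b n x)).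
apply: max_run_ge; apply: infix_trans (prefixW (code_prefix x nn')).
by apply: infix_trans (prefixW ps) (infix_drop _ _).
Qed.
End MaxRun.

(** * Almost sure bounds along geometric scales *)
Section TypicalRuns.
Context {R : realType} (a : R).
Hypotheses (a0 : 0 < a) (a1 : a < 1).
Implicit Types (v : seq bool) (i k N p : nat).

Local Notation leb := (@lebesgue_measure R).
Local Notation len := (word_len a).
Local Notation code := (code a).
Let mg := word_len_ge0 a0 a1.
Let md := word_lenD a0.

(** Converts the failure probability of [N] trials of success probability [x]
    into a bound that is summable as soon as [N * x] grows geometrically. *)
Lemma exprB1_le (x : R) N : 0 <= x <= 1 -> (1 - x) ^+ N * (N%:R * x) <= 1.
Proof.
move=> /andP[x0 x1].
have h : (1 - x) ^+ N * (1 + N%:R * x) <= 1.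
  elim: N => [|N IH]; first by rewrite expr0 mul0r; lra.
  apply: le_trans IH; rewrite exprSr -mulrA ler_wpM2l//.
    by rewrite exprn_ge0//; lra.
  have : 0 <= N.+1%:R * x ^+ 2 by rewrite mulr_ge0// exprn_ge0.
  by rewrite -natr1; lra.
have : 0 <= (1 - x) ^+ N by rewrite exprn_ge0//; lra.
lra.
Qed.

Lemma exprB1_ge (x : R) N : 0 <= x <= 1 -> 1 - N%:R * x <= (1 - x) ^+ N.
Proof.
move=> /andP[x0 x1]; elim: N => [|N IH]; first by rewrite expr0 mul0r; lra.
rewrite exprSr; apply: (@le_trans _ _ ((1 - N%:R * x) * (1 - x))).
  have : 0 <= N%:R * x ^+ 2 by rewrite mulr_ge0// exprn_ge0.
  by rewrite -natr1; lra.
by rewrite ler_wpM2r//; lra.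
Qed.

Lemma pow2_gt0 N : 0 < (2 : R) ^+ N. Proof. by rewrite exprn_gt0. Qed.

Lemma half_exprE N : (2^-1 : R) ^+ N = (2 ^+ N)^-1.
Proof. by rewrite exprVn. Qed.

Lemma ones_upper p i n :
  prob len (fun v => 0 < \sum_(s < 2 ^ (p.+3 * i))
    prefix (nseq (p.+4 * i) true) (drop s v))%N n [::] <= 1 * 2^-1 ^+ i.
Proof.
apply: le_trans (prob_some_window mg md _ _ _) _.
  by move=> w; apply: (word_len_ones_le a0 a1).
rewrite word_len_nil mulr1 natrX mul1r !half_exprE.
rewrite [(p.+4 * i)%N]mulSn exprD.
have := pow2_gt0 i; have := pow2_gt0 (p.+3 * i).
move: (2 ^+ (p.+3 * i)) (2 ^+ i) => A B A0 B0.
by rewrite le_eqVlt; apply/orP/or_introl/eqP; field; rewrite !gt_eqF.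
Qed.

(** Runs of zeros are measured at scale [2 ^ (p.+3 * i)]: the two thresholds are
    that scale raised to the power [a], up to the factors [p.+4 / p.+3] and
    [p / p.+3] in the exponent. *)
Definition zero_run_upper p i : nat := (Num.truncn ((2 ^+ (p.+4 * i) : R) `^ a)).+1.

Lemma zeros_upper p i n :
  prob len (fun v => prefix (nseq (zero_run_upper p i) false) v ||
    (0 < \sum_(s < 2 ^ (p.+3 * i))
      prefix (true :: nseq (zero_run_upper p i) false) (drop s v))%N) n [::] <=
  2 * (3 / a) `^ a^-1 * 2^-1 ^+ i.
Proof.
set k := zero_run_upper p i; set C := (3 / a) `^ a^-1.
have ck : zero_len a k <= C / 2 ^+ (p.+4 * i).
  by apply: zero_len_le_of => //; rewrite ?pow2_gt0// ltW// truncnS_gt.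
apply: (le_trans (prob_or _ _ _ _ _)) => //.
apply: (@le_trans _ _ (zero_len a k + 2 ^+ (p.+3 * i) * zero_len a k)).
  apply: lerD.
    apply: (le_trans (prob_prefix mg md _ _ _)).
    by rewrite cat0s word_len_zeros.
  apply: le_trans (prob_some_window mg md _ _ _) _.
    by move=> w; apply: (word_len_one_zeros_le a0 a1).
  by rewrite word_len_nil mulr1 natrX.
have A1 : 1 <= (2 : R) ^+ (p.+3 * i) by rewrite exprn_ege1//; lra.
have c0 := zero_len_gt0 a0 k.
apply: (@le_trans _ _ (2 * 2 ^+ (p.+3 * i) * (C / 2 ^+ (p.+4 * i)))).
  move: (_ ^+ (p.+3 * i)) A1 ck => A A1 ck; nra.
rewrite half_exprE [(p.+4 * i)%N]mulSn exprD.
have := pow2_gt0 i; have := pow2_gt0 (p.+3 * i).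
move: (2 ^+ (p.+3 * i)) (2 ^+ i) => A B A0 B0.
by rewrite le_eqVlt; apply/orP/or_introl/eqP; field; rewrite !gt_eqF.
Qed.

Definition zero_ratio : R := 2^-1 `^ ((1 - a) / a).

Lemma zero_ratio01 : 0 <= zero_ratio < 1.
Proof.
have [ha hb] := (a0, a1).
rewrite powR_ge0/= /zero_ratio.
have e1 : 1 `^ ((1 - a) / a) = 1 :> R by rewrite powR1.
rewrite -[ltRHS]e1; apply: gt0_ltr_powR; rewrite ?nnegrE; try lra.
by rewrite divr_gt0//; lra.
Qed.

Lemma zero_tail_le i :
  zero_tail a (2 ^ i) <=
  2 / (1 - a) * ((3 / a) `^ a^-1) `^ (1 - a) * zero_ratio ^+ i.
Proof.
have [ha hb] := (a0, a1).
set Y := (2 ^+ i : R) `^ a^-1.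
have Y0 : 0 < Y by rewrite powR_gt0// pow2_gt0.
have Ya : Y `^ a <= (2 ^ i)%N%:R.
  by rewrite /Y -powRrM mulVf ?gt_eqF// powRr1 ?natrX// ltW// pow2_gt0.
have := zero_len_le_of a0 a1 Y0 Ya; set C := _ `^ a^-1 => ck.
have c0 := zero_len_gt0 a0 (2 ^ i).
have C0 : 0 <= C by exact: powR_ge0.
rewrite /zero_tail -[leRHS]mulrA ler_wpM2l//; first by rewrite divr_ge0//; lra.
apply: (@le_trans _ _ ((C / Y) `^ (1 - a))).
  apply: ge0_ler_powR; rewrite ?nnegrE ?divr_ge0// ?ltW//; lra.
rewrite powRM ?invr_ge0 ?(ltW Y0)// ler_wpM2l ?powR_ge0//.
have p2 (x y : R) : (2 `^ x) `^ y = 2 `^ (x * y) by rewrite powRrM.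
have Yi : Y^-1 = 2 `^ (- (i%:R / a)) by rewrite /Y -powR_mulrn// p2 powRN.
have ri : zero_ratio = 2 `^ (- ((1 - a) / a)).
  by rewrite /zero_ratio -powR_inv1// p2 mulN1r.
rewrite Yi ri -(powR_mulrn i (powR_ge0 _ _)) !p2.
by rewrite le_eqVlt; apply/orP/or_introl/eqP; congr (_ `^ _); ring.
Qed.

(** Markov's inequality: the expected number of windows of zeros is a small
    fraction of the number of windows. *)
Lemma zero_windows_few p i n :
  prob len (fun v => 2 ^ (p.+3 * i) <= \sum_(s < 2 * 2 ^ (p.+3 * i))
    prefix (nseq (2 ^ i) false) (drop s v))%N n [::] <=
  2 * (2 / (1 - a) * ((3 / a) `^ a^-1) `^ (1 - a)) * zero_ratio ^+ i.
Proof.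
set N := (2 ^ _)%N.
have N0 : 0 < N%:R :> R by rewrite ltr0n expn_gt0.
rewrite -(ler_pM2l N0).
have /le_trans := @prob_markov R len mg md (2 * N) N
  (fun s v => prefix (nseq (2 ^ i) false) (drop s v)) n [::]; apply.
apply: (@le_trans _ _ (\sum_(s < 2 * N) zero_tail a (2 ^ i))).
  apply: ler_sum => s _.
  apply: (@prob_zero_window R len mg md (zero_len a) (zero_tail a)).
  - exact: word_len_one_zeros_le a0 a1.
  - by move=> k; rewrite word_len_zeros.
  - exact: word_len_nil.
  - exact: zero_tail_step a0 a1.
  - exact: zero_len_le_tail a0 a1.
  - by rewrite expn_gt0.
rewrite sumr_const card_ord -[leLHS]mulr_natl natrM.
have := zero_tail_le i; set D := (_ * zero_ratio ^+ i) => h.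
have -> : N%:R * (2 * (2 / (1 - a) * ((3 / a) `^ a^-1) `^ (1 - a)) * zero_ratio ^+ i)
  = 2 * N%:R * D by rewrite /D; ring.
by rewrite ler_wpM2l// mulr_ge0.
Qed.

Definition zero_run_lower p i : nat := Num.truncn ((2 ^+ (p * i) : R) `^ a).

(** There are [2 ^ (p.+2 * i)] trials, of success probability at least
    of order [2 ^- (p * i)]. *)
Lemma zeros_lower p i n :
  prob len (fun v => norun false (zero_run_lower p i) 0 v &&
    (2 ^ (p.+2 * i) <= count id v)%N) n [::] <=
  2 * (2 `^ a^-1) * 2^-1 ^+ i.
Proof.
set k := zero_run_lower p i.
have Y1 : 1 <= (2 : R) ^+ (p * i) by rewrite exprn_ege1//; lra.
have Ya : 1 <= ((2 : R) ^+ (p * i)) `^ a.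
  have e1 : 1 `^ a = 1 :> R by rewrite powR1.
  rewrite -[leLHS]e1; apply: ge0_ler_powR; rewrite ?nnegrE; (exact: ltW || lra).
have k0 : (0 < k)%N by rewrite truncn_gt0.
have ck : 2^-1 `^ a^-1 / 2 / 2 ^+ (p * i) <= zero_len a k.
  by apply: zero_len_ge_of => //; rewrite truncn_le; lra.
have := zero_trials mg md (2 ^ (p.+2 * i)).-1 n (zero_len01 a0 k) k0
  (fun w => word_len_zeros_ge a0 a1 w k).
rewrite prednK ?expn_gt0// word_len_nil mulr1 => /le_trans; apply.
have := exprB1_le (2 ^ (p.+2 * i)) (zero_len01 a0 k).
move: ck; have c0 := zero_len_gt0 a0 k.
have i0 : 0 < (2 : R)^-1 `^ a^-1 by rewrite powR_gt0.
have -> : 2 `^ a^-1 = (2^-1 `^ a^-1)^-1 :> R.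
  by rewrite -powRN -[in RHS](powR_inv1 (_ : 0 <= 2))// -powRrM; congr powR; ring.
move: (_ `^ _) i0 (zero_len a k) c0 => C C0 c c0 ck.
set X := _ ^+ (2 ^ _); rewrite natrX !half_exprE.
have -> : (p.+2 * i = i + (i + p * i))%N by rewrite !mulSn.
rewrite !exprD; have := pow2_gt0 i; have : 1 <= (2 : R) ^+ i by rewrite exprn_ege1//; lra.
have := pow2_gt0 (p * i); move: ck.
move: (2 ^+ (p * i)) (2 ^+ i) => A B ck A0 B1 B0 h.
rewrite -ler_pdivlMr in h; last by rewrite !mulr_gt0.
apply: (le_trans h); rewrite mul1r.
have -> : 2 * C^-1 / B = (B * (C / 2))^-1 by field; rewrite !gt_eqF.
rewrite ler_pdivrMr// in ck.
rewrite lef_pV2 ?posrE; first last.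
- by rewrite mulr_gt0//; lra.
- by rewrite !mulr_gt0.
rewrite -!mulrA ler_pM2l//; apply: (le_trans ck).
by rewrite mulrC ler_peMl// mulr_ge0// ltW.
Qed.

(** A run of length [K] has conditional probability [d = 2 ^- K.+1] to follow; the
    weight [q] below satisfies [1 - d <= q ^+ K] by Bernoulli's inequality. *)
Lemma ones_lower p i n :
  prob len (fun v => norun true (p * i).+1 0 v &&
    (2 ^ (p.+2 * i) <= count id v)%N) n [::] <=
  8 * p.+1%:R * 2^-1 ^+ i.
Proof.
set K := (p * i).+1; set N := (2 ^ _)%N.
pose d : R := 2^-1 ^+ K.+1; pose q : R := 1 - d / K%:R.
have K1 : 1 <= K%:R :> R by rewrite ler1n.
have d0 : 0 < d by rewrite exprn_gt0//; lra.
have dh : d <= 2^-1.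
  by rewrite /d exprS; have := half_expr01 (R:=R) K; lra.
have dK : 0 < d / K%:R <= d.
  by rewrite divr_gt0 ?ler_pdivrMr ?ler_peMr//; lra.
have q01 : 0 < q <= 1 by rewrite /q; lra.
have qK : 1 - d <= q ^+ K.
  have := @exprB1_ge (d / K%:R) K ltac:(lra).
  by rewrite mulrC divfK// gt_eqF//; lra.
have := one_trials mg md N n [::] q01 qK (ltn0Sn _)
  (fun w => word_len_ones_ge a0 a1 w (ltn0Sn _)).
rewrite word_len_nil mulr1 => /le_trans; apply.
have qK2 : 2^-1 <= q ^+ K by lra.
have qN : q ^+ N * (N%:R * (d / K%:R)) <= 1 by apply: exprB1_le; lra.
have qN0 : 0 <= q ^+ N by rewrite exprn_ge0//; lra.
apply: (@le_trans _ _ (2 * q ^+ N)).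
  rewrite ler_pdivrMr; last lra.
  nra.
have Ki : K%:R <= p.+1%:R * 2 ^+ i :> R.
  rewrite -natrX -natrM ler_nat /K mulSn.
  by rewrite -[leqLHS]add1n leq_add ?expn_gt0// leq_mul// ltnW// ltn_expl.
have N0 : 0 < N%:R :> R by rewrite ltr0n expn_gt0.
have {}qN : q ^+ N <= K%:R / (N%:R * d).
  rewrite ler_pdivlMr; last exact: mulr_gt0 N0 d0.
  move: qN.
  by rewrite !mulrA ler_pdivrMr ?mul1r//; lra.
apply: (@le_trans _ _ (2 * (p.+1%:R * 2 ^+ i / (N%:R * d)) : R)).
  by rewrite ler_pM2l//; apply: (le_trans qN); rewrite ler_pM2r// invr_gt0; exact: mulr_gt0 N0 d0.
rewrite /N /d /K natrX !half_exprE !exprS.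
have -> : (p.+2 * i = i + (i + p * i))%N by rewrite !mulSn.
rewrite !exprD; have := pow2_gt0 i; have := pow2_gt0 (p * i).
move: (2 ^+ (p * i)) (2 ^+ i) => A B A0 B0.
by rewrite le_eqVlt; apply/orP/or_introl/eqP; field; rewrite !gt_eqF.
Qed.

Lemma many_ones p i v : size v = (2 ^ (p.+3 * i + 2))%N ->
  ~~ (2 ^ (p.+3 * i) <= \sum_(s < 2 * 2 ^ (p.+3 * i))
    prefix (nseq (2 ^ i) false) (drop s v))%N ->
  (2 ^ (p.+2 * i) <= count id v)%N.
Proof.
move=> sv; rewrite -ltnNge => few.
have := @count_ge_windows (2 * 2 ^ (p.+3 * i)) (2 ^ i) v.
have i0 : (0 < 2 ^ i)%N by rewrite expn_gt0.
have e : (2 ^ (p.+3 * i) = 2 ^ i * 2 ^ (p.+2 * i))%N by rewrite -expnD -mulSn.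
have n0 : (0 < 2 ^ (p.+2 * i))%N by rewrite expn_gt0.
rewrite sv expnD => /(_ _) h.
have {}h := h ltac:(by nia).
set T := (\sum_(_ < _) _)%N in few; set F := (\sum_(_ < _) _)%N in h.
have TF : (T + F = 2 * 2 ^ (p.+3 * i))%N.
  rewrite /T /F -big_split/= (eq_bigr (fun=> 1%N)); first by rewrite sum1_card card_ord.
  by move=> s _; case: prefix.
rewrite -(leq_pmul2l i0) -e; lia.
Qed.

(** At each scale five events of geometrically small mass are discarded: too long
    a run of ones, too long a fresh run of zeros, too few ones, and many ones
    without a long run of zeros, or without a long run of ones. *)
Lemma typical_runs :
  {ae leb, forall x : R, unitI R x -> forall p, exists i0, forall i, (i0 <= i)%N ->
    [/\ (max_run a 1 (2 ^ (p.+3 * i)) x <= p.+4 * i)%N,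
        (p * i <= max_run a 1 (2 ^ (p.+3 * i + 2)) x)%N,
        (max_run a 0 (2 ^ (p.+3 * i)) x < zero_run_upper p i)%N &
        (zero_run_lower p i <= max_run a 0 (2 ^ (p.+3 * i + 2)) x)%N]}.
Proof.
have half01 : 0 <= (2^-1 : R) < 1 by lra.
have lebF := ae_filter_ringOfSetsType leb.
suff : {ae leb, forall x, forall p, unitI R x -> exists i0, forall i, (i0 <= i)%N ->
    [/\ (max_run a 1 (2 ^ (p.+3 * i)) x <= p.+4 * i)%N,
        (p * i <= max_run a 1 (2 ^ (p.+3 * i + 2)) x)%N,
        (max_run a 0 (2 ^ (p.+3 * i)) x < zero_run_upper p i)%N &
        (zero_run_lower p i <= max_run a 0 (2 ^ (p.+3 * i + 2)) x)%N]}.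
  by move=> h; apply: (@filterS _ _ lebF _ _ _ h) => x H ux p; exact: H.
apply: ae_foralln => p.
have H1 := code_borel_cantelli a0 a1 half01
  (fun i => ones_upper p i (2 ^ (p.+3 * i))).
have H2 := code_borel_cantelli a0 a1 half01
  (fun i => zeros_upper p i (2 ^ (p.+3 * i))).
have H3 := code_borel_cantelli a0 a1 zero_ratio01
  (fun i => zero_windows_few p i (2 ^ (p.+3 * i + 2))).
have H4 := code_borel_cantelli a0 a1 half01
  (fun i => zeros_lower p i (2 ^ (p.+3 * i + 2))).
have H5 := code_borel_cantelli a0 a1 half01
  (fun i => ones_lower p i (2 ^ (p.+3 * i + 2))).
apply: (@filterS _ _ lebF _ _ _ (@filterI _ _ lebF _ _ H1
  (@filterI _ _ lebF _ _ H2 (@filterI _ _ lebF _ _ H3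
  (@filterI _ _ lebF _ _ H4 H5))))).
move=> x [h1 [h2 [h3 [h4 h5]]]] ux.
have [i1 {}h1] := h1 ux; have [i2 {}h2] := h2 ux; have [i3 {}h3] := h3 ux.
have [i4 {}h4] := h4 ux; have [i5 {}h5] := h5 ux.
exists (i1 + i2 + i3 + i4 + i5).+1%N => i hi.
have {}h1 := h1 i ltac:(lia); have {}h2 := h2 i ltac:(lia).
have {}h3 := h3 i ltac:(lia); have {}h4 := h4 i ltac:(lia).
have {}h5 := h5 i ltac:(lia).
have ones := many_ones (size_code _ _ _) h3.
rewrite ones andbT in h4; rewrite ones andbT in h5.
have some (F : nat -> bool) N s : (s < N)%N -> F s -> (0 < \sum_(s < N) F s)%N.
  by move=> sN Fs; rewrite (bigD1 (Ordinal sN))//= Fs.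
split.
- rewrite leqNgt; apply: contra h1 => h.
  have [s sk ps] := @max_run_window _ a true _ _ _ (ltnW h).
  apply: (some (fun s => prefix _ (drop s _)) _ s _ ps).
  by apply: leq_trans sk; rewrite -[ltnLHS]addn0 ltn_add2l; nia.
- apply: leq_trans (leqnSn _) _; apply: (@max_run_ge _ a true).
  exact: norun_infix h5.
- rewrite ltnNge; apply: contra h2 => h.
  have [s sk ps] := @max_run_window _ a false _ _ _ h.
  have [->//|[s' ss' ps']] := first_zero_run (ltn0Sn _) ps.
  apply/orP; right; apply: (some (fun s => prefix _ (drop s _)) _ s' _ ps').
  by apply: leq_trans ss' _; apply: leq_trans sk; rewrite leq_addr.
- apply: (@max_run_ge _ a false); exact: norun_infix h4.
Qed.
End TypicalRuns.

(** * From geometric scales to limits *)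
Section LogLimits.
Context {R : realType}.
Implicit Types (p i n : nat).

Lemma ln_nat_le m n : (m <= n)%N -> ln m%:R <= ln n%:R :> R.
Proof.
case: m => [|m] mn; last by rewrite ler_ln ?posrE ?ltr0n ?ler_nat//; lia.
rewrite ln0//; case: n {mn} => [|n]; first by rewrite ln0.
by rewrite ln_ge0// ler1n.
Qed.

Lemma ln2_gt0 : 0 < ln 2 :> R. Proof. by rewrite ln_gt0//; lra. Qed.

Lemma log2_nat_bounds n t : (2 ^ t <= n < 2 ^ t.+1)%N ->
  t%:R <= log2 (n%:R : R) <= t%:R + 1.
Proof.
move=> /andP[tn nt]; have l2 := ln2_gt0.
have E k : ln (2 ^ k)%:R = k%:R * ln 2 :> R.
  by rewrite natrX lnXn// mulr_natl.
rewrite /log2 natr1 ler_pdivlMr// ler_pdivrMr// -!E.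
by rewrite !ln_nat_le// ltnW.
Qed.

(** Between consecutive scales [2 ^ (p.+3 * i)] the logarithm changes by
    a bounded amount, and the ratios [p.+4 / p.+3] and [p / p.+3] tend to [1] when
    [p] grows. *)
Lemma log2_sandwich (f : nat -> R) (C : R) :
  {homo f : m n / (m <= n)%N >-> m <= n} ->
  (forall p, exists i0, forall i, (i0 <= i)%N ->
    f (2 ^ (p.+3 * i))%N <= (p.+4 * i)%:R /\
    (p * i)%:R - C <= f (2 ^ (p.+3 * i + 2))%N) ->
  (fun n => f n / log2 n%:R) @ \oo --> (1 : R).
Proof.
move=> fle fb; apply/cvgrPdist_le => e e0.
pose p := Num.truncn (4 / e); have [i0 {}fb] := fb p.
pose q : nat := p.+3.
have qe : 4 <= e * q%:R.
  have : 4 / e < p.+1%:R by exact: truncnS_gt.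
  rewrite ltr_pdivrMr// mulrC => h.
  apply: (le_trans (ltW h)); rewrite ler_pM2l// ler_nat /q; lia.
pose B : R := q%:R * (q%:R + 2 + `|C|).
pose M := (q * i0 + 2 + (Num.truncn B).+1)%N.
near=> n.
have n2M : (2 ^ M <= n)%N by near: n; exists (2 ^ M)%N.
have n0 : (0 < n)%N by apply: leq_trans n2M; rewrite expn_gt0.
pose t := trunc_log 2 n.
have tn : (2 ^ t <= n < 2 ^ t.+1)%N by rewrite trunc_logP// trunc_log_ltn.
have Mt : (M <= t)%N by rewrite trunc_log_max.
have qt : (q * i0 + 2 <= t)%N by rewrite (leq_trans _ Mt)// leq_addr.
have t2 : (2 <= t)%N by rewrite (leq_trans _ qt)// leq_addl.
have /andP[lt1 lt2] := log2_nat_bounds tn.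
have lB : B <= log2 n%:R.
  apply: le_trans lt1; apply: (@le_trans _ _ (Num.truncn B).+1%:R).
    by rewrite ltW// truncnS_gt.
  by rewrite ler_nat (leq_trans _ Mt)// leq_addl.
move: lt1 lt2 lB; set l := log2 _ => lt1 lt2 lB.
have q1 : 1 <= q%:R :> R by rewrite ler1n.
have C0 := normr_ge0 C; have CC := ler_norm C.
have qC : q%:R * C <= q%:R * `|C| by rewrite ler_wpM2l//; lra.
have qC0 : 0 <= q%:R * `|C| by rewrite mulr_ge0//; lra.
have l0 : 0 < l by apply: lt_le_trans lB; rewrite mulr_gt0//; lra.
(* Rounding up to the next scale [i] costs at most [q] in the exponent. *)
have up : q%:R * f n <= (q%:R + 4) * l.
  pose i := (t %/ q).+1.
  have ti : (t < q * i)%N by rewrite mulnC ltn_ceil.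
  have it : (q * i <= t + q)%N by rewrite mulnS addnC leq_add2r mulnC leq_trunc_div.
  have i0i : (i0 <= i)%N.
    rewrite -(@leq_pmul2l q)//; apply: leq_trans (leq_trans Mt (ltnW ti)).
    by rewrite /M -addnA leq_addr.
  have [fu _] := fb i i0i.
  have fn : f n <= (p.+4 * i)%:R.
    apply: le_trans fu; apply: fle; apply: ltnW.
    apply: (leq_trans (proj2 (andP tn))).
    by rewrite leq_exp2l.
  have itR : q%:R * i%:R <= l + q%:R :> R.
    by apply: (@le_trans _ _ (t%:R + q%:R)); rewrite ?lerD2r// -natrM -natrD ler_nat.
  have q4 : p.+4%:R = q%:R + 1 :> R by rewrite natr1.
  rewrite natrM q4 in fn.
  apply: (@le_trans _ _ ((q%:R + 1) * (q%:R * i%:R))).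
    by rewrite mulrCA ler_pM2l//; lra.
  apply: (@le_trans _ _ ((q%:R + 1) * (l + q%:R))); first by rewrite ler_pM2l//; lra.
  rewrite /B in lB; lra.
have low : (q%:R - 4) * l <= q%:R * f n.
  pose i := ((t - 2) %/ q)%N.
  have ti : (t < q * i + q + 2)%N.
    have := @ltn_ceil (t - 2) q isT; rewrite -/i mulSn [(i * q)%N]mulnC.
    by rewrite ltn_subLR// => h; apply: (leq_trans h); rewrite addnC [(q + _)%N]addnC.
  have it : (q * i + 2 <= t)%N.
    have := leq_trunc_div (t - 2) q; rewrite -/i [(i * q)%N]mulnC.
    by rewrite leq_subRL// addnC.
  have i0i : (i0 <= i)%N.
    by rewrite leq_divRL// mulnC leq_subRL// addnC.
  have [_ fd] := fb i i0i.
  have fn : (p * i)%:R - C <= f n.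
    apply: (le_trans fd); apply: fle; apply: leq_trans (proj1 (andP tn)).
    by rewrite leq_exp2l.
  have tiR : l <= q%:R * i%:R + q%:R + 2 :> R.
    apply: (le_trans lt2); by rewrite natr1 -natrM -2!natrD ler_nat; exact: ti.
  have q3 : p%:R = q%:R - 3 :> R by rewrite /q -addn3 natrD addrK.
  have p0 : 0 <= p%:R :> R by [].
  rewrite natrM in fn.
  have h1 : q%:R * (p%:R * i%:R - C) <= q%:R * f n by rewrite ler_pM2l//; lra.
  have h2 : p%:R * (l - q%:R - 2) <= p%:R * (q%:R * i%:R).
    by rewrite ler_wpM2l//; lra.
  rewrite q3 in h1 h2; rewrite /B in lB; lra.
rewrite ler_distlC; apply/andP; split.
  rewrite ler_pdivlMr//; nra.
rewrite ler_pdivrMr//; nra.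
Unshelve. all: by end_near.
Qed.
End LogLimits.

Theorem theorem1 (R : realType) (alpha : R) (halpha : 0 < alpha < 1)
    (mu : probability (measurableTypeR R) R) (hmu : is_acip alpha mu) :
  {ae mu, forall x : R, unitI R x ->
    (fun n : nat => ln (max_run alpha 0 n x)%:R / ln (n%:R `^ alpha))
      @ \oo --> (1 : R) /\
    (fun n : nat => (max_run alpha 1 n x)%:R / log2 n%:R)
      @ \oo --> (1 : R)}.
Proof.
have /andP[a0 a1] := halpha; have [_ _ mu_leb] := hmu.
have [A [mA lA sA]] := typical_runs a0 a1.
exists A; split => //.
  by move/null_content_dominatesP : mu_leb; exact.
move=> x nx; apply: sA => runs; apply: nx => ux.
have {}runs := runs ux; have l2 := @ln2_gt0 R.
split; last first.
  apply: (@log2_sandwich R (fun n => (max_run alpha 1 n x)%:R) 0).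
    by move=> m n mn; rewrite ler_nat; exact: (@max_run_le _ alpha true).
  move=> p; have [i0 {}runs] := runs p; exists i0 => i /runs[u l _ _].
  by rewrite subr0 !ler_nat.
have al2 : 0 < alpha * ln 2 by rewrite mulr_gt0.
pose f n := ln (max_run alpha 0 n x)%:R / (alpha * ln 2).
rewrite (_ : (fun n : nat => _) = (fun n => f n / log2 n%:R)); last first.
  apply/funext => n; rewrite ln_powR /f /log2 !invfM invrK.
  rewrite -!mulrA; congr (_ * (_ * _)).
  by rewrite mulrCA mulVf ?mulr1// gt_eqF.
apply: (@log2_sandwich R f alpha^-1).
  move=> m n mn; rewrite /f ler_pM2r ?invr_gt0//.
  by apply: ln_nat_le; exact: (@max_run_le _ alpha false).
move=> p; have [i0 {}runs] := runs p; exists i0 => i /runs[_ _ u l].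
have lnY k : ln ((2 ^+ k : R) `^ alpha) = k%:R * (alpha * ln 2).
  by rewrite ln_powR lnXn// -mulr_natl; ring.
split.
  rewrite /f ler_pdivrMr// -lnY; set Y := _ `^ _.
  apply: (@le_trans _ _ (ln (Num.truncn Y)%:R)); first by apply: ln_nat_le.
  have Y1 : 1 <= Y.
    have e1 : 1 `^ alpha = 1 :> R by rewrite powR1.
    rewrite /Y -[leLHS]e1; apply: ge0_ler_powR; rewrite ?nnegrE ?exprn_ege1 ?exprn_ge0//; lra.
  rewrite ler_ln ?posrE ?truncn_le ?ltr0n ?truncn_gt0//; lra.
rewrite /f ler_pdivlMr// mulrBl -lnY mulKf ?gt_eqF//.
apply: le_trans (ln_nat_le l).
rewrite /zero_run_lower; set Y := _ `^ _.
have Y1 : 1 <= Y.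
  have e1 : 1 `^ alpha = 1 :> R by rewrite powR1.
  rewrite /Y -[leLHS]e1; apply: ge0_ler_powR; rewrite ?nnegrE ?exprn_ege1 ?exprn_ge0//; lra.
have T0 : (0 < Num.truncn Y)%N by rewrite truncn_gt0.
have TY : Y <= (Num.truncn Y)%:R * 2.
  have := truncnS_gt Y; rewrite -natr1.
  have : 1 <= (Num.truncn Y)%:R :> R by rewrite ler1n.
  lra.
rewrite lerBlDr -lnM ?posrE ?ltr0n//.
by rewrite ler_ln ?posrE ?mulr_gt0 ?ltr0n//; lra.
Qed.
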